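(* For all $0<\epsilon<1$ and any pair of channels $\mathcal{N},\mathcal{M}:A\to B$ between finite-dimensional systems, $$\liminf_{n\to\infty}\frac1n D^\epsilon_{\max}(\mathcal{N}^{\otimes n}\|\mathcal{M}^{\otimes n})\ge D(\mathcal{N}\|\mathcal{M}),$$ where $D(\mathcal{N}\|\mathcal{M})=\sup_C\sup_{\rho\in\mathcal{S}(A\otimes C)}D\bigl((\mathcal{N}\otimes\mathrm{id}_C)(\rho)\,\|\,(\mathcal{M}\otimes\mathrm{id}_C)(\rho)\bigr)$, with $C$ ranging over auxiliary systems and $D(\rho\|\sigma)$ the quantum (Umegaki) relative entropy of states.
   Context: $\mathcal{S}(A)$ denotes the set of density operators on $A$; $\|\cdot\|_\diamond$ is the diamond norm. For completely positive maps $\mathcal{N},\mathcal{M}:A\to B$, $D_{\max}(\mathcal{N}\|\mathcal{M})=\log\min\{\lambda:\lambda\mathcal{M}-\mathcal{N}\text{ is completely positive}\}$ ($+\infty$ if no such $\lambda$), and for channels the $\epsilon$-smooth version is $D^\epsilon_{\max}(\mathcal{N}\|\mathcal{M})=\inf\{D_{\max}(\mathcal{N}'\|\mathcal{M}):\mathcal{N}'\text{ a channel }A\to B,\ \tfrac12\|\mathcal{N}'-\mathcal{N}\|_\diamond\le\epsilon\}$. *)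

(* Defs.v *)
From Stdlib Require Import Reals Lra Arith.
Open Scope R_scope.

Record Cplx := mkC { re : R; im : R }.
Definition C0 : Cplx := mkC 0 0.
Definition C1 : Cplx := mkC 1 0.
Definition RtoC (r : R) : Cplx := mkC r 0.
Definition Cadd (x y : Cplx) : Cplx := mkC (re x + re y) (im x + im y).
Definition Copp (x : Cplx) : Cplx := mkC (- re x) (- im x).
Definition Cmul (x y : Cplx) : Cplx :=
  mkC (re x * re y - im x * im y) (re x * im y + im x * re y).
Definition Cconj (x : Cplx) : Cplx := mkC (re x) (- im x).

Fixpoint csum (n : nat) (f : nat -> Cplx) : Cplx :=
  match n with O => C0 | S m => Cadd (csum m f) (f m) end.
Fixpoint rsum (n : nat) (f : nat -> R) : R :=
  match n with O => 0 | S m => rsum m f + f m end.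

(* ---------- matrices (entries outside the stated dimensions are ignored) *)
Definition Mat := nat -> nat -> Cplx.

Definition meq (m n : nat) (A B : Mat) : Prop :=
  forall i j, (i < m)%nat -> (j < n)%nat -> A i j = B i j.
Definition mmul (k : nat) (A B : Mat) : Mat :=
  fun i j => csum k (fun l => Cmul (A i l) (B l j)).
Definition adj (A : Mat) : Mat := fun i j => Cconj (A j i).
Definition idm : Mat := fun i j => if Nat.eqb i j then C1 else C0.
Definition diag (s : nat -> R) : Mat :=
  fun i j => if Nat.eqb i j then RtoC (s i) else C0.
Definition trace (n : nat) (A : Mat) : Cplx := csum n (fun i => A i i).

Definition unitary (n : nat) (U : Mat) : Prop :=
  meq n n (mmul n (adj U) U) idm /\ meq n n (mmul n U (adj U)) idm.
Definition hermitian (n : nat) (A : Mat) : Prop :=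
  forall i j, (i < n)%nat -> (j < n)%nat -> A i j = Cconj (A j i).
Definition psd (n : nat) (A : Mat) : Prop :=
  hermitian n A /\
  forall v : nat -> Cplx,
    0 <= re (csum n (fun i => Cmul (Cconj (v i))
                                   (csum n (fun j => Cmul (A i j) (v j))))).
Definition density (n : nat) (rho : Mat) : Prop := psd n rho /\ trace n rho = C1.

(* ---------- linear maps between matrix spaces ----------
   A linear map Phi : L(C^a) -> L(C^b) is given by its coefficients:
   Phi(X)_{ij} = sum_{k,l < a} K i j k l * X_{kl}. *)
Definition SupOp := nat -> nat -> nat -> nat -> Cplx.

Definition apply (a : nat) (K : SupOp) (X : Mat) : Mat :=
  fun i j => csum a (fun k => csum a (fun l => Cmul (K i j k l) (X k l))).

(* Tensor product of maps K1 : a1 -> b1 and K2 : a2 -> b2 (on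
   C^{a1} (x) C^{a2} with index (i1, i2) |-> i1 * a2 + i2, etc.). *)
Definition ktens (a2 b2 : nat) (K1 K2 : SupOp) : SupOp :=
  fun i j k l =>
    Cmul (K1 (i / b2) (j / b2) (k / a2) (l / a2))%nat
         (K2 (i mod b2) (j mod b2) (k mod a2) (l mod a2))%nat.

Definition idK : SupOp :=
  fun i j k l => if andb (Nat.eqb i k) (Nat.eqb j l) then C1 else C0.

Fixpoint tpow (a b : nat) (K : SupOp) (n : nat) : SupOp :=
  match n with
  | O => fun _ _ _ _ => C1
  | S m => ktens a b (tpow a b K m) K
  end.

Definition Ksub (K1 K2 : SupOp) : SupOp :=
  fun i j k l => Cadd (K1 i j k l) (Copp (K2 i j k l)).
Definition Kscale (r : R) (K : SupOp) : SupOp :=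
  fun i j k l => Cmul (RtoC r) (K i j k l).

Definition positive_map (a b : nat) (K : SupOp) : Prop :=
  forall X, psd a X -> psd b (apply a K X).
Definition CP (a b : nat) (K : SupOp) : Prop :=
  forall k : nat, positive_map (a * k) (b * k) (ktens k k K idK).
Definition TP (a b : nat) (K : SupOp) : Prop :=
  forall X, trace b (apply a K X) = trace a X.
Definition channel (a b : nat) (K : SupOp) : Prop := CP a b K /\ TP a b K.

Definition is_trace_norm (n : nat) (X : Mat) (t : R) : Prop :=
  exists (U V : Mat) (s : nat -> R),
    unitary n U /\ unitary n V /\ (forall i, 0 <= s i) /\
    meq n n X (mmul n U (mmul n (diag s) (adj V))) /\ t = rsum n s.
Definition trace_norm_le (n : nat) (X : Mat) (c : R) : Prop :=
  exists t, is_trace_norm n X t /\ t <= c.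

Definition diamond_le (a b : nat) (K : SupOp) (c : R) : Prop :=
  forall (k : nat) (X : Mat),
    trace_norm_le (a * k) X 1 ->
    trace_norm_le (b * k) (apply (a * k) (ktens k k K idK) X) c.

(* D_max(N || M) >= r, where D_max = log min {lam : lam M - N is CP}
   (= +infinity if there is no such lam) *)
Definition Dmax_ge (a b : nat) (N M : SupOp) (r : R) : Prop :=
  forall lam : R, 0 < lam -> CP a b (Ksub (Kscale lam M) N) -> r <= ln lam.

(* D^eps_max(N || M) >= r: the infimum over channels N' with
   (1/2)||N' - N||_diamond <= eps of D_max(N' || M) is >= r *)
Definition smooth_Dmax_ge (eps : R) (a b : nat) (N M : SupOp) (r : R) : Prop :=
  forall N' : SupOp,
    channel a b N' -> diamond_le a b (Ksub N' N) (2 * eps) ->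
    Dmax_ge a b N' M r.

Inductive ERbar := Fin (r : R) | PInf.
Definition ER_lt (x y : ERbar) : Prop :=
  match x, y with
  | Fin r, Fin s => r < s
  | Fin _, PInf => True
  | PInf, _ => False
  end.

Definition spectral (n : nat) (A U : Mat) (lam : nat -> R) : Prop :=
  unitary n U /\ meq n n A (mmul n U (mmul n (diag lam) (adj U))).

(* D(rho || sigma) = Tr rho (log rho - log sigma), computed from spectral
   decompositions rho = U diag(lam) U^*, sigma = V diag(mu) V^*:
   Tr rho log rho = sum_i lam_i ln lam_i  (0 ln 0 = 0),
   Tr rho log sigma = sum_j ln(mu_j) <v_j|rho|v_j>,
   and D = +infinity if supp rho is not contained in supp sigma, i.e. some
   eigenvector v_j of sigma with eigenvalue 0 has <v_j|rho|v_j> <> 0. *)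
Definition rel_entropy (n : nat) (rho sigma : Mat) (d : ERbar) : Prop :=
  exists (U V : Mat) (lam mu : nat -> R),
    spectral n rho U lam /\ spectral n sigma V mu /\
    let p := fun j => re (mmul n (adj V) (mmul n rho V) j j) in
    let viol := exists j, (j < n)%nat /\ mu j = 0 /\ p j <> 0 in
    (viol /\ d = PInf) \/
    (~ viol /\
     d = Fin (rsum n (fun i => lam i * ln (lam i))
              - rsum n (fun j => p j * ln (mu j)))).

Definition channel_rel_entropy_gt (a b : nat) (N M : SupOp) (y : R) : Prop :=
  exists (c : nat) (rho : Mat) (d : ERbar),
    density (a * c) rho /\
    rel_entropy (b * c) (apply (a * c) (ktens c c N idK) rho)
                        (apply (a * c) (ktens c c M idK) rho) d /\
    ER_lt (Fin y) d.

(* Main.v *)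
From Stdlib Require Import Reals Lra Lia Arith.
From mathcomp Require all_boot all_order all_algebra complex Rstruct.
Require Import Defs.
Open Scope R_scope.

(* Fix an input [rho] on [A (x) C] with outputs [om] and [tau] under [N] and [M],
   and feed [rho^n] to the block channels.  If [L0 M^n - N'] is completely
   positive and [N'] is [eps]-close to [N^n], the output [om'] of [N'] satisfies
   [om' <= L0 tau^n] and [|| om' - om^n ||_1 <= 2 eps], so it suffices to find tests
   [0 <= E <= 1] with [Tr E om^n -> 1] and [Tr E tau^n <= exp (- n y)].

   Take [E = Q P Q], with [P] the spectral projection of [om^n] onto eigenvalues at
   least [exp (n (Tr om log om - delta))] and [Q] that of [tau^n] onto eigenvalues at
   most [exp (n (Tr om log tau + delta))].  Then
   [Tr E tau^n <= rank P * exp (n (Tr om log tau + delta))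
    <= exp (- n (D (om || tau) - 2 delta))].  By Chebyshev's inequality,
   applied to the spectrum of [om] and to the diagonal of [om] in an eigenbasis
   of [tau], both projections have [om^n]-weight close to [1], and then so does
   [E], because [<u|E|u> >= <u|Q|u>^2 >= 2 <u|Q|u> - 1] for [u] in the range of [P]. *)

(** * The spectral theorem *)

Module Spectral.
Import all_boot all_order all_algebra complex Rstruct.
Set Implicit Arguments.
Import GRing.Theory Num.Theory Num.Def.
Local Open Scope ring_scope.
Local Open Scope sesquilinear_scope.

Local Notation K := (complex R).

Definition toK (x : Cplx) : K := Complex (re x) (im x).
Definition ofK (x : K) : Cplx := mkC (complex.Re x) (complex.Im x).

Lemma toKK x : toK (ofK x) = x.
Proof. by case: x. Qed.

Lemma ofKK x : ofK (toK x) = x.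
Proof. by case: x. Qed.

Lemma ofK_mul x y : ofK (x * y) = Cmul (ofK x) (ofK y).
Proof. by case: x => a b; case: y => c d. Qed.

Lemma ofK_conj (x : K) : ofK (conjC x) = Cconj (ofK x).
Proof. by case: x. Qed.

Lemma ofK_sum n (f : nat -> K) :
  ofK (\sum_(i < n) f i) = csum n (fun i => ofK (f i)).
Proof.
elim: n => [|n IH]; first by rewrite big_ord0.
rewrite big_ord_recr /= -IH.
by case: (\sum_(i < n) _) => a b; case: (f n).
Qed.

Definition tomx n (A : Mat) : 'M[K]_n := \matrix_(i, j) toK (A i j).
Definition ofmx n (A : 'M[K]_n) : Mat :=
  fun i j => if insub i is Some i' then
               if insub j is Some j' then ofK (A i' j') else C0 else C0.

Lemma ofmxE n (A : 'M[K]_n) (i j : 'I_n) : ofmx A i j = ofK (A i j).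
Proof. by rewrite /ofmx !valK. Qed.

Lemma meqP n (A B : Mat) :
  (forall i j : 'I_n, A i j = B i j) -> meq n n A B.
Proof.
move=> h i j /ltP hi /ltP hj; exact: (h (Ordinal hi) (Ordinal hj)).
Qed.

Lemma csum_ordE n (f : nat -> Cplx) : csum n f = ofK (\sum_(i < n) toK (f i)).
Proof.
rewrite (ofK_sum n (fun i => toK (f i))).
by elim: n => //= n ->; rewrite ofKK.
Qed.

Lemma ofmx_mul n (A B : 'M[K]_n) (X Y : Mat) (i j : 'I_n) :
  (forall k : 'I_n, X i k = ofK (A i k)) ->
  (forall k : 'I_n, Y k j = ofK (B k j)) ->
  mmul n X Y i j = ofK ((A *m B) i j).
Proof.
move=> hX hY; rewrite /mmul csum_ordE mxE; congr ofK.
by apply: eq_bigr => k _; rewrite hX hY -ofK_mul toKK.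
Qed.

Lemma ofmx_adj n (A : 'M[K]_n) (i j : 'I_n) : adj (ofmx A) i j = ofK (A ^t* i j).
Proof. by rewrite /adj ofmxE !mxE -ofK_conj. Qed.

Lemma ofK_1 n (i j : 'I_n) : ofK ((1%:M : 'M[K]_n) i j) = idm i j.
Proof.
rewrite mxE /idm -val_eqE /=.
by case: PeanoNat.Nat.eqb_spec => [->|/eqP/negbTE ->]; rewrite ?eqxx.
Qed.

(** Transported from the spectral theorem for normal matrices over [complex R]. Hermitian symmetry
    makes the eigenvalues real, so [lam] may keep their real parts only. *)
Lemma hermitian_spectral n A : Defs.hermitian n A -> exists U lam, spectral n A U lam.
Proof.
move=> hA; pose B := tomx n A.
have hB : B \is hermsymmx.
  apply/is_hermitianmxP; rewrite expr0 scale1r; apply/matrixP => i j.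
  rewrite !mxE (hA i j); [|exact/ltP|exact/ltP].
  by rewrite -[RHS]toKK ofK_conj ofKK.
have /orthomx_spectralP hS := hermitian_normalmx hB.
have hr := hermitian_spectral_diag_real hB.
have hu := spectral_unitarymx B.
rewrite (invmx_unitary hu) in hS.
set P := spectralmx B in hS hu; set D := spectral_diag B in hS hr.
have hu1 := unitarymxP hu.
have hu2 : P^t* *m P = 1%:M by rewrite -(invmx_unitary hu) mulVmx // unitarymx_unit.
pose lam i := if insub i is Some i' then complex.Re (D 0 i') else 0.
have hP (i j : 'I_n) : adj (ofmx (P^t*)) i j = ofK (P i j).
  by rewrite ofmx_adj trmxCK.
(* The decomposition reads [B = P^t* *m diag_mx D *m P]; since [spectral] puts the unitary on the
   left, the witness is the adjoint of [P]. *)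
exists (ofmx (P^t*)), lam; split; first split.
- apply: meqP => i j; rewrite -ofK_1 -hu1; apply: ofmx_mul => k //.
  exact: ofmxE.
- apply: meqP => i j; rewrite -ofK_1 -hu2; apply: ofmx_mul => k //.
  exact: ofmxE.
apply: meqP => i j.
have -> : A i j = ofK (B i j) by rewrite mxE ofKK.
rewrite hS -mulmxA; symmetry; apply: ofmx_mul => k; first exact: ofmxE.
apply: ofmx_mul => l; last exact: hP.
rewrite /diag mxE -val_eqE /=.
case: PeanoNat.Nat.eqb_spec => [e|/eqP/negbTE ->]; last by rewrite mulr0n.
have -> : l = k by apply: val_inj.
rewrite eqxx mulr1n /lam valK.
have /complex_realP [x ->] : D 0 k \is Num.real by move/mxOverP: hr; apply.
by [].
Qed.
End Spectral.

(** * Complex numbers and finite sums *)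

Lemma Cplx_eq (x y : Cplx) : re x = re y -> im x = im y -> x = y.
Proof. destruct x, y; simpl; intros -> ->; reflexivity. Qed.

Definition Csub (x y : Cplx) : Cplx := Cadd x (Copp y).

Lemma Cplx_ring : ring_theory C0 C1 Cadd Cmul Csub Copp eq.
Proof.
  constructor; intros; try reflexivity;
    apply Cplx_eq; simpl; ring.
Qed.
Add Ring Cplx_ring : Cplx_ring.

Definition Cnorm2 (x : Cplx) : R := re x * re x + im x * im x.

Lemma Cnorm2_ge0 (x : Cplx) : 0 <= Cnorm2 x.
Proof. unfold Cnorm2; nra. Qed.

Lemma Cconj_mul (x y : Cplx) : Cconj (Cmul x y) = Cmul (Cconj x) (Cconj y).
Proof. apply Cplx_eq; simpl; ring. Qed.

Lemma Cconj_add (x y : Cplx) : Cconj (Cadd x y) = Cadd (Cconj x) (Cconj y).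
Proof. apply Cplx_eq; simpl; ring. Qed.

Lemma Cconj_conj (x : Cplx) : Cconj (Cconj x) = x.
Proof. apply Cplx_eq; simpl; ring. Qed.

Lemma Cconj_real (r : R) : Cconj (RtoC r) = RtoC r.
Proof. apply Cplx_eq; simpl; ring. Qed.

Lemma Cmul_conj_self (x : Cplx) : Cmul (Cconj x) x = RtoC (Cnorm2 x).
Proof. apply Cplx_eq; unfold Cnorm2; simpl; ring. Qed.

Lemma RtoC_mul (x y : R) : RtoC (x * y) = Cmul (RtoC x) (RtoC y).
Proof. apply Cplx_eq; simpl; ring. Qed.

Lemma csum_ext n (f g : nat -> Cplx) :
  (forall i, (i < n)%nat -> f i = g i) -> csum n f = csum n g.
Proof.
  induction n as [|n IH]; simpl; intros H; [reflexivity|].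
  rewrite IH, (H n); auto.
Qed.

Lemma csum_zero n : csum n (fun _ => C0) = C0.
Proof. induction n as [|n IH]; simpl; [|rewrite IH]; ring. Qed.

Lemma csum_add n f g :
  csum n (fun i => Cadd (f i) (g i)) = Cadd (csum n f) (csum n g).
Proof. induction n as [|n IH]; simpl; [|rewrite IH]; ring. Qed.

Lemma csum_opp n f : csum n (fun i => Copp (f i)) = Copp (csum n f).
Proof. induction n as [|n IH]; simpl; [|rewrite IH]; ring. Qed.

Lemma csum_mul_l n x f : csum n (fun i => Cmul x (f i)) = Cmul x (csum n f).
Proof. induction n as [|n IH]; simpl; [|rewrite IH]; ring. Qed.

Lemma csum_mul_r n x f : csum n (fun i => Cmul (f i) x) = Cmul (csum n f) x.
Proof. induction n as [|n IH]; simpl; [|rewrite IH]; ring. Qed.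

Lemma csum_conj n f : Cconj (csum n f) = csum n (fun i => Cconj (f i)).
Proof.
  induction n as [|n IH]; simpl; [|rewrite Cconj_add, IH; reflexivity].
  apply Cplx_eq; simpl; ring.
Qed.

Lemma csum_swap m n (f : nat -> nat -> Cplx) :
  csum m (fun i => csum n (fun j => f i j)) =
  csum n (fun j => csum m (fun i => f i j)).
Proof.
  induction m as [|m IH]; simpl; [rewrite csum_zero; reflexivity|].
  rewrite IH, csum_add; reflexivity.
Qed.

Lemma csum_delta n k f :
  (k < n)%nat -> csum n (fun i => if Nat.eqb k i then f i else C0) = f k.
Proof.
  induction n as [|n IH]; simpl; intros Hk; [lia|].
  destruct (Nat.eqb_spec k n) as [->|Hne].
  - rewrite (csum_ext n _ (fun _ => C0)); [rewrite csum_zero; ring|].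
    intros i Hi; destruct (Nat.eqb_spec n i); [lia|reflexivity].
  - rewrite IH by lia; ring.
Qed.

Lemma csum_shift m n f :
  csum (m + n) f = Cadd (csum m f) (csum n (fun i => f (m + i)%nat)).
Proof.
  induction n as [|n IH]; [rewrite Nat.add_0_r; simpl; ring|].
  rewrite Nat.add_succ_r; simpl; rewrite IH; ring.
Qed.

Lemma divmod_pair k i j :
  (j < k)%nat -> ((i * k + j) / k = i /\ (i * k + j) mod k = j)%nat.
Proof.
  intros Hj; split.
  - rewrite Nat.div_add_l by lia; rewrite Nat.div_small by lia; lia.
  - rewrite Nat.add_comm, Nat.Div0.mod_add; apply Nat.mod_small; lia.
Qed.

(** The flat index [i * k + j] is the tensor convention of [ktens], so this opens a sum over a
    tensor product factor by factor. *)
Lemma csum_pair m k (F : nat -> nat -> Cplx) :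
  csum (m * k) (fun x => F (x / k)%nat (x mod k)%nat) =
  csum m (fun i => csum k (fun j => F i j)).
Proof.
  induction m as [|m IH]; simpl; [reflexivity|].
  rewrite Nat.add_comm, csum_shift, IH; f_equal.
  apply csum_ext; intros j Hj.
  destruct (divmod_pair k m j Hj) as [-> ->]; reflexivity.
Qed.

Lemma rsum_csum n f : RtoC (rsum n f) = csum n (fun i => RtoC (f i)).
Proof.
  induction n as [|n IH]; simpl; [reflexivity|].
  rewrite <- IH; apply Cplx_eq; simpl; ring.
Qed.

Lemma re_csum n f : re (csum n f) = rsum n (fun i => re (f i)).
Proof. induction n as [|n IH]; simpl; [reflexivity|rewrite IH; reflexivity]. Qed.

Lemma rsum_ext n f g :
  (forall i, (i < n)%nat -> f i = g i) -> rsum n f = rsum n g.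
Proof.
  induction n as [|n IH]; simpl; intros H; [reflexivity|].
  rewrite IH, (H n); auto.
Qed.

Lemma rsum_add n f g : rsum n (fun i => f i + g i) = rsum n f + rsum n g.
Proof. induction n as [|n IH]; simpl; [|rewrite IH]; ring. Qed.

Lemma rsum_sub n f g : rsum n (fun i => f i - g i) = rsum n f - rsum n g.
Proof. induction n as [|n IH]; simpl; [|rewrite IH]; ring. Qed.

Lemma rsum_mul_l n x f : rsum n (fun i => x * f i) = x * rsum n f.
Proof. induction n as [|n IH]; simpl; [|rewrite IH]; ring. Qed.

Lemma rsum_le n f g :
  (forall i, (i < n)%nat -> f i <= g i) -> rsum n f <= rsum n g.
Proof.
  induction n as [|n IH]; simpl; intros H; [lra|].
  apply Rplus_le_compat; auto.
Qed.

Lemma rsum_ge0 n f : (forall i, (i < n)%nat -> 0 <= f i) -> 0 <= rsum n f.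
Proof.
  induction n as [|n IH]; simpl; intros H; [lra|].
  apply Rplus_le_le_0_compat; auto.
Qed.

Lemma rsum_swap m n (f : nat -> nat -> R) :
  rsum m (fun i => rsum n (fun j => f i j)) =
  rsum n (fun j => rsum m (fun i => f i j)).
Proof.
  induction m as [|m IH]; simpl.
  - induction n as [|n IH]; simpl; lra.
  - rewrite IH, rsum_add; reflexivity.
Qed.

Lemma rsum_ge_term n k f :
  (k < n)%nat -> (forall i, (i < n)%nat -> 0 <= f i) -> f k <= rsum n f.
Proof.
  induction n as [|n IH]; intros Hk H; [lia|]; simpl.
  assert (0 <= rsum n f) by (apply rsum_ge0; auto).
  destruct (Nat.eq_dec k n) as [->|]; [lra|].
  assert (f k <= rsum n f) by (apply IH; auto; lia).
  assert (0 <= f n) by auto; lra.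
Qed.

(** * Vectors, unitaries and spectral decompositions *)

Definition mv (d : nat) (A : Mat) (v : nat -> Cplx) : nat -> Cplx :=
  fun i => csum d (fun j => Cmul (A i j) (v j)).
Definition ip (d : nat) (u v : nat -> Cplx) : Cplx :=
  csum d (fun i => Cmul (Cconj (u i)) (v i)).
Definition qf (d : nat) (A : Mat) (v : nat -> Cplx) : Cplx := ip d v (mv d A v).
Definition nrm2 (d : nat) (v : nat -> Cplx) : R := rsum d (fun i => Cnorm2 (v i)).
Definition col (A : Mat) (j : nat) : nat -> Cplx := fun i => A i j.

Lemma ip_ext d u u' v v' :
  (forall i, (i < d)%nat -> u i = u' i) ->
  (forall i, (i < d)%nat -> v i = v' i) -> ip d u v = ip d u' v'.
Proof. intros Hu Hv; apply csum_ext; intros; rewrite Hu, Hv; auto. Qed.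

Lemma ip_conj d u v : ip d u v = Cconj (ip d v u).
Proof.
  unfold ip; rewrite csum_conj; apply csum_ext; intros.
  rewrite Cconj_mul, Cconj_conj; ring.
Qed.

Lemma mv_ext d A v v' i :
  (forall j, (j < d)%nat -> v j = v' j) -> mv d A v i = mv d A v' i.
Proof. intros H; apply csum_ext; intros; rewrite H; auto. Qed.

Lemma ip_self d v : ip d v v = RtoC (nrm2 d v).
Proof.
  unfold nrm2, ip; rewrite rsum_csum.
  apply csum_ext; intros; apply Cmul_conj_self.
Qed.

Lemma ip_mv d A u v : ip d u (mv d A v) = ip d (mv d (adj A) u) v.
Proof.
  unfold ip, mv, adj.
  rewrite (csum_ext d _ (fun i => csum d (fun j =>
    Cmul (Cconj (u i)) (Cmul (A i j) (v j))))) by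
    (intros; rewrite csum_mul_l; reflexivity).
  rewrite csum_swap; apply csum_ext; intros j _.
  rewrite csum_conj, <- csum_mul_r; apply csum_ext; intros.
  rewrite Cconj_mul, Cconj_conj; ring.
Qed.

Lemma mv_mmul d A B v i : mv d (mmul d A B) v i = mv d A (mv d B v) i.
Proof.
  unfold mv, mmul.
  rewrite (csum_ext d _ (fun j => csum d (fun l =>
    Cmul (Cmul (A i l) (B l j)) (v j)))) by
    (intros; rewrite csum_mul_r; reflexivity).
  rewrite csum_swap; apply csum_ext; intros l _.
  rewrite <- csum_mul_l; apply csum_ext; intros; ring.
Qed.

Lemma mv_meq d A B v i : meq d d A B -> (i < d)%nat -> mv d A v i = mv d B v i.
Proof. intros H Hi; apply csum_ext; intros; rewrite H; auto. Qed.

Lemma mv_idm d v i : (i < d)%nat -> mv d idm v i = v i.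
Proof.
  intros Hi; unfold mv, idm.
  rewrite <- (csum_delta d i v Hi); apply csum_ext; intros j _.
  destruct (Nat.eqb i j); ring.
Qed.

Lemma mv_diag d s v i : (i < d)%nat -> mv d (diag s) v i = Cmul (RtoC (s i)) (v i).
Proof.
  intros Hi; unfold mv, diag.
  rewrite <- (csum_delta d i (fun j => Cmul (RtoC (s j)) (v j)) Hi).
  apply csum_ext; intros j _.
  destruct (Nat.eqb_spec i j) as [->|]; ring.
Qed.

Lemma mv_adj_unitary d U v i :
  unitary d U -> (i < d)%nat -> mv d (adj U) (mv d U v) i = v i.
Proof.
  intros [H _] Hi; rewrite <- mv_mmul, (mv_meq d _ idm) by assumption.
  apply mv_idm; assumption.
Qed.

Lemma mv_unitary_adj d U v i :
  unitary d U -> (i < d)%nat -> mv d U (mv d (adj U) v) i = v i.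
Proof.
  intros [_ H] Hi; rewrite <- mv_mmul, (mv_meq d _ idm) by assumption.
  apply mv_idm; assumption.
Qed.

Lemma RtoC_inj (x y : R) : RtoC x = RtoC y -> x = y.
Proof. unfold RtoC; congruence. Qed.

Lemma nrm2_adj_unitary d U v : unitary d U -> nrm2 d (mv d (adj U) v) = nrm2 d v.
Proof.
  intros HU; apply RtoC_inj; rewrite <- !ip_self, <- ip_mv.
  apply ip_ext; intros; [reflexivity|apply mv_unitary_adj; auto].
Qed.

Lemma nrm2_col d U j : unitary d U -> (j < d)%nat -> nrm2 d (col U j) = 1.
Proof.
  intros [H _] Hj; apply RtoC_inj; rewrite <- ip_self.
  generalize (H j j Hj Hj); unfold idm; rewrite Nat.eqb_refl; intros H1.
  exact H1.
Qed.

Lemma mv_svd d X U V s v i :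
  meq d d X (mmul d U (mmul d (diag s) (adj V))) -> (i < d)%nat ->
  mv d X v i = mv d U (fun k => Cmul (RtoC (s k)) (mv d (adj V) v k)) i.
Proof.
  intros H Hi; rewrite (mv_meq d _ _ v i H Hi), mv_mmul.
  apply mv_ext; intros k Hk; rewrite mv_mmul; apply mv_diag; assumption.
Qed.

(** Two unitaries are allowed so that the formula serves both spectral decompositions, where
    [U = V], and the singular value decompositions of [is_trace_norm]. *)
Lemma qf_svd d X U V s v :
  meq d d X (mmul d U (mmul d (diag s) (adj V))) ->
  qf d X v = csum d (fun k => Cmul (RtoC (s k))
    (Cmul (Cconj (mv d (adj U) v k)) (mv d (adj V) v k))).
Proof.
  intros H; unfold qf.
  rewrite (ip_ext d v v _ (mv d U (fun k => Cmul (RtoC (s k)) (mv d (adj V) v k))))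
    by (intros; try apply mv_svd; auto).
  rewrite ip_mv; apply csum_ext; intros; ring.
Qed.

Lemma qf_spectral d A U l v :
  spectral d A U l ->
  qf d A v = RtoC (rsum d (fun k => l k * Cnorm2 (mv d (adj U) v k))).
Proof.
  intros [_ H]; rewrite (qf_svd d A U U l v H), rsum_csum.
  apply csum_ext; intros; rewrite Cmul_conj_self, RtoC_mul; reflexivity.
Qed.

Lemma trace_svd d X U V s :
  meq d d X (mmul d U (mmul d (diag s) (adj V))) ->
  trace d X = csum d (fun k => Cmul (RtoC (s k)) (ip d (col V k) (col U k))).
Proof.
  intros H; unfold trace.
  rewrite (csum_ext d _ (fun i => csum d (fun k =>
    Cmul (RtoC (s k)) (Cmul (Cconj (V i k)) (U i k))))).
  - rewrite csum_swap; apply csum_ext; intros k _.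
    unfold ip, col; rewrite <- csum_mul_l; reflexivity.
  - intros i Hi; rewrite (H i i Hi Hi); apply csum_ext; intros k Hk.
    change (mmul d (diag s) (adj V) k i) with (mv d (diag s) (col (adj V) i) k).
    rewrite mv_diag by assumption; unfold col, adj; ring.
Qed.

Lemma trace_spectral d A U l :
  spectral d A U l -> trace d A = RtoC (rsum d l).
Proof.
  intros [HU H]; rewrite (trace_svd d A U U l H), rsum_csum.
  apply csum_ext; intros k Hk; rewrite ip_self, nrm2_col by assumption.
  apply Cplx_eq; simpl; ring.
Qed.

Lemma mv_adj_col d U k i :
  unitary d U -> (k < d)%nat -> (i < d)%nat ->
  mv d (adj U) (col U k) i = if Nat.eqb i k then C1 else C0.
Proof. intros [H _] Hk Hi; exact (H i k Hi Hk). Qed.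

Lemma spectral_eigenvalue d A U l k :
  spectral d A U l -> (k < d)%nat -> qf d A (col U k) = RtoC (l k).
Proof.
  intros HS Hk; rewrite (qf_spectral d A U l _ HS), rsum_csum.
  rewrite <- (csum_delta d k (fun i => RtoC (l i)) Hk).
  apply csum_ext; intros i Hi; destruct HS as [HU _].
  rewrite mv_adj_col, (Nat.eqb_sym k) by assumption.
  destruct (Nat.eqb i k); unfold Cnorm2; apply Cplx_eq; simpl; ring.
Qed.

Lemma psd_qf d A v : psd d A -> 0 <= re (qf d A v).
Proof. intros [_ H]; apply H. Qed.

Lemma psd_eigenvalue d A U l k :
  psd d A -> spectral d A U l -> (k < d)%nat -> 0 <= l k.
Proof.
  intros HA HS Hk; generalize (psd_qf d A (col U k) HA).
  rewrite (spectral_eigenvalue d A U l k HS Hk); auto.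
Qed.

Lemma spectral_hermitian d A U l : spectral d A U l -> hermitian d A.
Proof.
  intros [_ H] i j Hi Hj; rewrite (H i j), (H j i) by assumption.
  unfold mmul at 1 3; rewrite csum_conj; apply csum_ext; intros k Hk.
  change (mmul d (diag l) (adj U) k j) with (mv d (diag l) (col (adj U) j) k).
  change (mmul d (diag l) (adj U) k i) with (mv d (diag l) (col (adj U) i) k).
  rewrite !mv_diag by assumption; unfold col, adj.
  rewrite !Cconj_mul, Cconj_conj, Cconj_real; ring.
Qed.

Lemma psd_of_spectral d A U l :
  spectral d A U l -> (forall k, (k < d)%nat -> 0 <= l k) -> psd d A.
Proof.
  intros HS Hl; split; [apply (spectral_hermitian d A U l HS)|].
  intros v; change (0 <= re (qf d A v)).
  rewrite (qf_spectral d A U l v HS); apply rsum_ge0; intros.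
  apply Rmult_le_pos; [auto|apply Cnorm2_ge0].
Qed.

(** * The one-shot converse *)

Section OneShot.

Variables (d : nat) (U V : Mat) (s r : nat -> R).
Hypothesis unitaryU : unitary d U.
Hypothesis unitaryV : unitary d V.
Hypothesis s_range : forall i, 0 <= s i <= 1.
Hypothesis r_range : forall i, 0 <= r i <= 1.

(* [Q = V diag(r) V^*] and [P = U diag(s) U^*]; the test is [Q P Q], so that
   [Tr (Q P Q X) = sum_y s_y <Q u_y| X |Q u_y>]. *)
Definition filter (v : nat -> Cplx) : nat -> Cplx :=
  mv d V (fun x => Cmul (RtoC (r x)) (mv d (adj V) v x)).

Lemma mv_adj_filter v x :
  (x < d)%nat -> mv d (adj V) (filter v) x = Cmul (RtoC (r x)) (mv d (adj V) v x).
Proof. intros Hx; apply mv_adj_unitary with (1 := unitaryV) (2 := Hx). Qed.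

Lemma ip_filter u v :
  ip d u (filter v) =
  csum d (fun x => Cmul (RtoC (r x))
    (Cmul (Cconj (mv d (adj V) u x)) (mv d (adj V) v x))).
Proof.
  unfold filter; rewrite ip_mv; apply csum_ext; intros; ring.
Qed.

Lemma ip_filter_sym u v : ip d (filter u) v = ip d u (filter v).
Proof.
  rewrite ip_conj, !ip_filter, csum_conj; apply csum_ext; intros.
  rewrite !Cconj_mul, Cconj_conj, Cconj_real; ring.
Qed.

Lemma nrm2_filter v : nrm2 d (filter v) <= nrm2 d v.
Proof.
  rewrite <- (nrm2_adj_unitary d V v), <- (nrm2_adj_unitary d V (filter v))
    by assumption.
  apply rsum_le; intros x Hx; rewrite mv_adj_filter by assumption.
  generalize (r_range x) (Cnorm2_ge0 (mv d (adj V) v x)).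
  generalize (mv d (adj V) v x) as z; unfold Cnorm2; simpl; intros z [H0 H1] H2.
  assert (r x * r x <= 1) by nra.
  replace (_ * _ + _ * _) with (r x * r x * (re z * re z + im z * im z)) by ring.
  nra.
Qed.

(** By symmetry of [Q] the left side is [<Qv|P|Qv>], at most [||Qv||^2] because [P <= 1], and [Q] is
    a contraction. *)
Lemma test_le_id v :
  rsum d (fun y => s y * Cnorm2 (ip d (filter (col U y)) v)) <= nrm2 d v.
Proof.
  apply Rle_trans with (2 := nrm2_filter v).
  rewrite <- (nrm2_adj_unitary d U (filter v)) by assumption.
  apply rsum_le; intros y Hy; rewrite ip_filter_sym.
  change (ip d (col U y) (filter v)) with (mv d (adj U) (filter v) y).
  generalize (s_range y) (Cnorm2_ge0 (mv d (adj U) (filter v) y)); nra.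
Qed.

(** This is [<u_y|Q|u_y>], expanded in the eigenbasis of [Q]. *)
Definition overlap (y : nat) : R :=
  rsum d (fun x => r x * Cnorm2 (mv d (adj V) (col U y) x)).

Lemma ip_col_filter y : ip d (col U y) (filter (col U y)) = RtoC (overlap y).
Proof.
  rewrite ip_filter; unfold overlap; rewrite rsum_csum.
  apply csum_ext; intros; rewrite Cmul_conj_self, RtoC_mul; reflexivity.
Qed.

Lemma overlap_le1 y : (y < d)%nat -> overlap y <= 1.
Proof.
  intros Hy; rewrite <- (nrm2_col d U y), <- (nrm2_adj_unitary d V) by assumption.
  apply rsum_le; intros x _.
  generalize (r_range x) (Cnorm2_ge0 (mv d (adj V) (col U y) x)); nra.
Qed.

(** [Q] and [tau] share the eigenbasis [V], so [Q tau Q] has eigenvalues [r x * r x * mu x <= mx],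
    and [u_y] is a unit vector. *)
Lemma test_second_state tau mu mx y :
  spectral d tau V mu -> 0 <= mx ->
  (forall x, (x < d)%nat -> r x * r x * mu x <= mx) -> (y < d)%nat ->
  re (qf d tau (filter (col U y))) <= mx.
Proof.
  intros HS Hmx Hmu Hy; rewrite (qf_spectral d tau V mu _ HS); simpl.
  rewrite <- (Rmult_1_r mx), <- (nrm2_col d U y), <- (nrm2_adj_unitary d V)
    by assumption.
  unfold nrm2; rewrite <- rsum_mul_l; apply rsum_le; intros x Hx.
  rewrite mv_adj_filter by assumption.
  generalize (Hmu x Hx) (Cnorm2_ge0 (mv d (adj V) (col U y) x)).
  generalize (mv d (adj V) (col U y) x) as z; unfold Cnorm2; simpl; intros z H1 H2.
  replace (mu x * _) with (r x * r x * mu x * (re z * re z + im z * im z)) by ring.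
  nra.
Qed.

(** Keeping only the eigenvector [u_y] of [om] leaves [lam y * q^2] with [q = overlap y], and
    [q^2 >= 2 * q - 1]. *)
Lemma test_first_state om lam y :
  spectral d om U lam -> (forall k, (k < d)%nat -> 0 <= lam k) -> (y < d)%nat ->
  lam y * (2 * overlap y - 1) <= re (qf d om (filter (col U y))).
Proof.
  intros HS Hl Hy; rewrite (qf_spectral d om U lam _ HS); simpl.
  apply Rle_trans with (lam y * Cnorm2 (mv d (adj U) (filter (col U y)) y)).
  - change (mv d (adj U) (filter (col U y)) y) with (ip d (col U y) (filter (col U y))).
    rewrite ip_col_filter; apply Rmult_le_compat_l; [auto|].
    generalize (Rle_0_sqr (overlap y - 1)); unfold Cnorm2, Rsqr; simpl; lra.
  - apply (rsum_ge_term d y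
      (fun k => lam k * Cnorm2 (mv d (adj U) (filter (col U y)) k)) Hy).
    intros; apply Rmult_le_pos; [auto|apply Cnorm2_ge0].
Qed.

Lemma Cnorm2_overlap x y :
  Cnorm2 (mv d (adj U) (col V x) y) = Cnorm2 (mv d (adj V) (col U y) x).
Proof.
  change (Cnorm2 (ip d (col U y) (col V x)) = Cnorm2 (ip d (col V x) (col U y))).
  rewrite ip_conj; unfold Cnorm2; simpl; ring.
Qed.

(** Both sides are [Tr om Q], computed in the eigenbasis of [om] and in that of [Q]. *)
Lemma sum_overlap om lam :
  spectral d om U lam ->
  rsum d (fun y => lam y * overlap y) =
  rsum d (fun x => r x * re (qf d om (col V x))).
Proof.
  intros HS; unfold overlap.
  rewrite (rsum_ext d _ (fun y => rsum d (fun x =>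
    lam y * (r x * Cnorm2 (mv d (adj V) (col U y) x))))) by
    (intros; rewrite rsum_mul_l; reflexivity).
  rewrite rsum_swap; apply rsum_ext; intros x _.
  rewrite (qf_spectral d om U lam _ HS); simpl; rewrite <- rsum_mul_l.
  apply rsum_ext; intros y _.
  rewrite (Cnorm2_overlap x); ring.
Qed.

Lemma sum_qf_col om lam :
  spectral d om U lam -> rsum d (fun x => re (qf d om (col V x))) = rsum d lam.
Proof.
  intros HS.
  rewrite (rsum_ext d _ (fun x => rsum d (fun y =>
    lam y * Cnorm2 (mv d (adj V) (col U y) x)))).
  - rewrite rsum_swap; apply rsum_ext; intros y Hy; rewrite rsum_mul_l.
    change (rsum d _) with (nrm2 d (mv d (adj V) (col U y))).
    rewrite nrm2_adj_unitary, nrm2_col by assumption; ring.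
  - intros x _; rewrite (qf_spectral d om U lam _ HS); simpl.
    apply rsum_ext; intros y _.
    rewrite (Cnorm2_overlap x); reflexivity.
Qed.

Lemma test_first_state_sum om lam th1 th2 :
  spectral d om U lam -> (forall k, (k < d)%nat -> 0 <= lam k) ->
  rsum d lam = 1 ->
  rsum d (fun y => (1 - s y) * lam y) <= th1 ->
  rsum d (fun x => (1 - r x) * re (qf d om (col V x))) <= th2 ->
  1 - th1 - 2 * th2 <= rsum d (fun y => s y * re (qf d om (filter (col U y)))).
Proof.
  intros HS Hl H1 Hs Hr.
  (* The termwise gap to [s y * lam y * (2 * q - 1)] is [2 * (1 - s y) * lam y * (1 - q)],
     nonnegative since [q = overlap y <= 1]. The sum of this lower bound is [2 Tr om Q - 1] minus
     the weight missed by [P]. *)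
  apply Rle_trans with
    (rsum d (fun y => 2 * (lam y * overlap y) - lam y - (1 - s y) * lam y)).
  - rewrite !rsum_sub, rsum_mul_l, (sum_overlap om lam HS).
    rewrite (rsum_ext d _ (fun x =>
      re (qf d om (col V x)) - r x * re (qf d om (col V x)))) in Hr by
      (intros; ring).
    rewrite rsum_sub, (sum_qf_col om lam HS) in Hr; lra.
  - apply rsum_le; intros y Hy.
    generalize (test_first_state om lam y HS Hl Hy) (overlap_le1 y Hy) (s_range y)
      (Hl y Hy).
    generalize (re (qf d om (filter (col U y)))) (overlap y); intros t q H2 H3 H4 H5.
    assert (s y * (lam y * (2 * q - 1)) <= s y * t) by
      (apply Rmult_le_compat_l; lra).
    assert (0 <= (1 - s y) * lam y * (1 - q)) by
      (repeat apply Rmult_le_pos; lra).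
    nra.
Qed.

(* For [0 <= E <= 1] polarization gives
   [Re <b|E|a> >= - <a-b|E|a-b> / 4 >= - ||a-b||^2 / 4 = (Re <b|a> - 1) / 2]. *)
Lemma test_polarization a b :
  nrm2 d a = 1 -> nrm2 d b = 1 ->
  (re (ip d b a) - 1) / 2 <=
  rsum d (fun y => s y *
    re (Cmul (Cconj (ip d a (filter (col U y)))) (ip d b (filter (col U y))))).
Proof.
  intros Ha Hb.
  set (e := fun i => Csub (a i) (b i)).
  assert (He : nrm2 d e = 2 - 2 * re (ip d b a)).
  { replace 2 with (nrm2 d a + nrm2 d b) at 1 by lra.
    unfold nrm2, ip; rewrite re_csum, <- rsum_mul_l, <- rsum_add, <- rsum_sub.
    apply rsum_ext; intros; unfold e, Cnorm2, Csub; simpl; ring. }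
  assert (Hip : forall w, ip d w e = Csub (ip d w a) (ip d w b)).
  { intros w; unfold ip, Csub; rewrite <- csum_opp, <- csum_add.
    apply csum_ext; intros; unfold e, Csub; ring. }
  generalize (test_le_id e); rewrite He; intros Hle.
  apply Rle_trans with (- / 4 *
    rsum d (fun y => s y * Cnorm2 (ip d (filter (col U y)) e))); [lra|].
  rewrite <- rsum_mul_l; apply rsum_le; intros y _.
  rewrite Hip, (ip_conj d a), (ip_conj d b).
  generalize (s_range y) (ip d (filter (col U y)) a) (ip d (filter (col U y)) b).
  intros [Hs _] z z'; unfold Cnorm2, Csub; simpl.
  assert (0 <= s y * ((re z + re z') * (re z + re z')
    + (im z + im z') * (im z + im z')))
    by (apply Rmult_le_pos; [exact Hs|apply Rplus_le_le_0_compat; apply Rle_0_sqr]).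
  nra.
Qed.

(** Write [X] as the sum of [g_k |a_k><b_k|]. Polarization bounds the k-th term of [Re Tr E X] below
    by [g_k (Re <b_k|a_k> - 1) / 2]; the overlaps add up to [Re Tr X = 0], which leaves
    [- t / 2]. *)
Lemma test_trace_norm X t :
  is_trace_norm d X t -> re (trace d X) = 0 ->
  - t / 2 <= rsum d (fun y => s y * re (qf d X (filter (col U y)))).
Proof.
  intros (A & B & g & HA & HB & Hg & HX & ->) Htr.
  rewrite (trace_svd d X A B g HX), re_csum in Htr.
  apply Rle_trans with (rsum d (fun k => g k * ((re (ip d (col B k) (col A k)) - 1) / 2))).
  - right.
    rewrite (rsum_ext d (fun k => g k * _) (fun k =>
      / 2 * (re (Cmul (RtoC (g k)) (ip d (col B k) (col A k))) - g k))) by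
      (intros; simpl; field).
    rewrite rsum_mul_l, rsum_sub, Htr; field.
  - rewrite (rsum_ext d (fun y => s y * _) (fun y => rsum d (fun k =>
      g k * (s y * re (Cmul (Cconj (ip d (col A k) (filter (col U y))))
                            (ip d (col B k) (filter (col U y)))))))).
    + rewrite rsum_swap; apply rsum_le; intros k Hk; rewrite rsum_mul_l.
      apply Rmult_le_compat_l; [auto|].
      apply test_polarization; apply nrm2_col; assumption.
    + intros y _; rewrite (qf_svd d X A B g _ HX), re_csum, <- rsum_mul_l.
      apply rsum_ext; intros k _.
      change (mv d (adj A) (filter (col U y)) k) with (ip d (col A k) (filter (col U y))).
      change (mv d (adj B) (filter (col U y)) k) with (ip d (col B k) (filter (col U y))).
      simpl; ring.
Qed.

(** The number [Tr E om'] is squeezed: it is at least [Tr E om - eps], as [X = om' - om] is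
    traceless with trace norm at most [2 * eps], and at most [L * Tr E tau], where each of the
    [rsum d s] vectors of [P] contributes at most [mx]. *)
Lemma one_shot_converse om om' tau X lam mu L th1 th2 eps mx :
  spectral d om U lam -> (forall k, (k < d)%nat -> 0 <= lam k) -> rsum d lam = 1 ->
  spectral d tau V mu -> 0 <= mx ->
  (forall x, (x < d)%nat -> r x * r x * mu x <= mx) ->
  rsum d (fun y => (1 - s y) * lam y) <= th1 ->
  rsum d (fun x => (1 - r x) * re (qf d om (col V x))) <= th2 ->
  0 <= L ->
  (forall v, re (qf d om' v) <= L * re (qf d tau v)) ->
  (forall v, re (qf d X v) = re (qf d om' v) - re (qf d om v)) ->
  trace_norm_le d X (2 * eps) -> re (trace d X) = 0 ->
  1 - th1 - 2 * th2 - eps <= L * mx * rsum d s.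
Proof.
  intros HSo Hl H1 HSt Hmx Hmu Hs Hr HL Hle HX (t & Ht & Hteps) Htr.
  generalize (test_trace_norm X t Ht Htr)
    (test_first_state_sum om lam th1 th2 HSo Hl H1 Hs Hr); intros HtX Hto.
  assert (Hup : rsum d (fun y => s y * re (qf d om' (filter (col U y))))
    <= L * mx * rsum d s).
  { rewrite <- rsum_mul_l; apply rsum_le; intros y Hy.
    generalize (Hle (filter (col U y)))
      (test_second_state tau mu mx y HSt Hmx Hmu Hy) (s_range y).
    generalize (re (qf d om' (filter (col U y)))) (re (qf d tau (filter (col U y)))).
    intros p q Hp Hq Hsy.
    assert (L * q <= L * mx) by (apply Rmult_le_compat_l; assumption).
    rewrite (Rmult_comm (L * mx)); apply Rmult_le_compat_l; lra. }
  rewrite (rsum_ext d _ (fun y => s y * re (qf d om' (filter (col U y)))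
    - s y * re (qf d om (filter (col U y))))) in HtX by
    (intros; rewrite HX; ring).
  rewrite rsum_sub in HtX; lra.
Qed.

End OneShot.

(** * Tensor powers of bipartite operators *)

(* [tp d c n W] is [W^{(x) n}] for [W] on [C^d (x) C^c], with the [n] first
   factors regrouped in front: a basis vector is a pair of indices [I < d^n],
   [J < c^n] whose base-[d] resp. base-[c] digits are the local indices. *)
Fixpoint tp (d c n : nat) (W : Mat) (I J I' J' : nat) : Cplx :=
  match n with
  | O => C1
  | S m => Cmul (tp d c m W (I / d) (J / c) (I' / d) (J' / c))
             (W (I mod d * c + J mod c) (I' mod d * c + J' mod c))%nat
  end.

(** The flat index [I * c ^ n + J] is the one used by [ktens (c ^ n) (c ^ n)], so block maps
    tensored with the identity on the reference apply directly. *)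
Definition stp (d c n : nat) (W : Mat) : Mat :=
  fun x y => tp d c n W (x / c ^ n) (x mod c ^ n) (y / c ^ n) (y mod c ^ n).

(** For a probability vector [f] this is the i.i.d. distribution on words of length [n]; for a local
    spectrum it is the spectrum of the tensor power. *)
Fixpoint pf (d c n : nat) (f : nat -> R) (I J : nat) : R :=
  match n with
  | O => 1
  | S m => pf d c m f (I / d) (J / c) * f (I mod d * c + J mod c)%nat
  end.

Definition spf (d c n : nat) (f : nat -> R) : nat -> R :=
  fun x => pf d c n f (x / c ^ n) (x mod c ^ n).

(** Under the distribution [pf], this is a sum of [n] independent copies of the random variable
    [f]. *)
Fixpoint sf (d c n : nat) (f : nat -> R) (I J : nat) : R :=
  match n with
  | O => 0
  | S m => sf d c m f (I / d) (J / c) + f (I mod d * c + J mod c)%nat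
  end.

Definition ssf (d c n : nat) (f : nat -> R) : nat -> R :=
  fun x => sf d c n f (x / c ^ n) (x mod c ^ n).

Lemma digit_lt d c I J :
  (0 < d)%nat -> (0 < c)%nat -> (I mod d * c + J mod c < d * c)%nat.
Proof.
  intros Hd Hc.
  generalize (Nat.mod_upper_bound I d) (Nat.mod_upper_bound J c); nia.
Qed.

Lemma digits_snoc d c I J z :
  (0 < c)%nat -> (z < d * c)%nat ->
  ((I * d + z / c) / d = I /\ (I * d + z / c) mod d = z / c /\
   (J * c + z mod c) / c = J /\ (J * c + z mod c) mod c = z mod c)%nat.
Proof.
  intros Hc Hz.
  assert (H1 : (z / c < d)%nat) by (apply Nat.Div0.div_lt_upper_bound; lia).
  assert (H2 : (z mod c < c)%nat) by (apply Nat.mod_upper_bound; lia).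
  destruct (divmod_pair d I _ H1), (divmod_pair c J _ H2); auto.
Qed.

Lemma div_mul_mod c z : (z / c * c + z mod c = z)%nat.
Proof. generalize (Nat.div_mod_eq z c); lia. Qed.

Section TensorPower.

Variables d c : nat.
Hypothesis d_gt0 : (0 < d)%nat.
Hypothesis c_gt0 : (0 < c)%nat.

(** Splits off the last tensor factor despite the regrouping: [I] and [J] each give up their lowest
    digit, and the two digits join into one local index [z]. Inductions on [n] over regrouped sums
    use this step. *)
Lemma csum_tensor_step n (F : nat -> nat -> Cplx) :
  csum (d ^ S n * c ^ S n) (fun x => F (x / c ^ S n) (x mod c ^ S n))%nat =
  csum (d ^ n * c ^ n) (fun x => csum (d * c) (fun z =>
    F (x / c ^ n * d + z / c) (x mod c ^ n * c + z mod c)))%nat.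
Proof.
  rewrite csum_pair.
  rewrite (csum_pair (d ^ n) (c ^ n) (fun I J => csum (d * c) (fun z =>
    F (I * d + z / c) (J * c + z mod c)))%nat).
  replace (d ^ S n)%nat with (d ^ n * d)%nat by apply Nat.mul_comm.
  replace (c ^ S n)%nat with (c ^ n * c)%nat by apply Nat.mul_comm.
  rewrite (csum_ext _ _ (fun x => csum (c ^ n * c) (fun y =>
    F (x / d * d + x mod d) y)%nat)) by (intros; rewrite div_mul_mod; reflexivity).
  rewrite (csum_pair (d ^ n) d (fun I i => csum (c ^ n * c) (fun y =>
    F (I * d + i) y)%nat)).
  apply csum_ext; intros I _.
  rewrite (csum_ext d _ (fun i => csum (c ^ n) (fun J => csum c (fun j =>
    F (I * d + i) (J * c + j))%nat))).
  - rewrite csum_swap; apply csum_ext; intros J _.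
    rewrite (csum_pair d c (fun i j => F (I * d + i) (J * c + j))%nat).
    reflexivity.
  - intros i _.
    rewrite (csum_ext _ _ (fun y => F (I * d + i) (y / c * c + y mod c))%nat)
      by (intros; rewrite div_mul_mod; reflexivity).
    apply (csum_pair (c ^ n) c (fun J j => F (I * d + i) (J * c + j))%nat).
Qed.

Lemma tp_snoc_r n W I J K L z :
  (z < d * c)%nat ->
  tp d c (S n) W I J (K * d + z / c) (L * c + z mod c) =
  Cmul (tp d c n W (I / d) (J / c) K L) (W (I mod d * c + J mod c) z)%nat.
Proof.
  intros Hz; simpl.
  destruct (digits_snoc d c K L z c_gt0 Hz) as (-> & -> & -> & ->).
  rewrite div_mul_mod; reflexivity.
Qed.

Lemma tp_snoc_l n W I J K L z :
  (z < d * c)%nat ->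
  tp d c (S n) W (K * d + z / c) (L * c + z mod c) I J =
  Cmul (tp d c n W K L (I / d) (J / c)) (W z (I mod d * c + J mod c))%nat.
Proof.
  intros Hz; simpl.
  destruct (digits_snoc d c K L z c_gt0 Hz) as (-> & -> & -> & ->).
  rewrite div_mul_mod; reflexivity.
Qed.

(** The sum over the last local index produces one entry of the local product and factors out,
    leaving the same sum for one factor less. *)
Lemma tp_mmul n A B I J I' J' :
  csum (d ^ n * c ^ n) (fun x =>
    Cmul (tp d c n A I J (x / c ^ n) (x mod c ^ n))
         (tp d c n B (x / c ^ n) (x mod c ^ n) I' J'))%nat =
  tp d c n (mmul (d * c) A B) I J I' J'.
Proof.
  revert I J I' J'; induction n as [|n IH]; intros I J I' J'; [simpl; ring|].
  rewrite (csum_tensor_step n (fun K L =>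
    Cmul (tp d c (S n) A I J K L) (tp d c (S n) B K L I' J'))).
  rewrite (csum_ext _ _ (fun x => Cmul
    (Cmul (tp d c n A (I / d) (J / c) (x / c ^ n) (x mod c ^ n))
          (tp d c n B (x / c ^ n) (x mod c ^ n) (I' / d) (J' / c)))
    (mmul (d * c) A B (I mod d * c + J mod c) (I' mod d * c + J' mod c)))%nat).
  - rewrite csum_mul_r, IH; reflexivity.
  - intros x _; unfold mmul; rewrite <- csum_mul_l; apply csum_ext; intros z Hz.
    rewrite tp_snoc_r, tp_snoc_l by assumption; ring.
Qed.

Lemma tp_meq n A B I J I' J' :
  meq (d * c) (d * c) A B -> tp d c n A I J I' J' = tp d c n B I J I' J'.
Proof.
  intros H; revert I J I' J'; induction n as [|n IH]; intros; [reflexivity|].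
  simpl; rewrite IH, H; auto using digit_lt.
Qed.

Lemma tp_adj n A I J I' J' :
  tp d c n (adj A) I J I' J' = Cconj (tp d c n A I' J' I J).
Proof.
  revert I J I' J'; induction n as [|n IH]; intros; simpl.
  - apply Cplx_eq; simpl; ring.
  - rewrite IH, Cconj_mul; reflexivity.
Qed.

Lemma eqb_div_mod k x y :
  Nat.eqb x y = (Nat.eqb (x / k) (y / k) && Nat.eqb (x mod k) (y mod k))%bool.
Proof.
  destruct (Nat.eqb_spec x y) as [->|Hne]; [rewrite !Nat.eqb_refl; reflexivity|].
  destruct (Nat.eqb_spec (x / k) (y / k)) as [H1|]; [|reflexivity].
  destruct (Nat.eqb_spec (x mod k) (y mod k)) as [H2|]; [|reflexivity].
  exfalso; apply Hne.
  rewrite <- (div_mul_mod k x), <- (div_mul_mod k y), H1, H2; reflexivity.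
Qed.

Lemma tp_diag n f I J I' J' :
  (I < d ^ n)%nat -> (J < c ^ n)%nat -> (I' < d ^ n)%nat -> (J' < c ^ n)%nat ->
  tp d c n (diag f) I J I' J' =
  if (Nat.eqb I I' && Nat.eqb J J')%bool then RtoC (pf d c n f I J) else C0.
Proof.
  revert I J I' J'; induction n as [|n IH]; intros I J I' J' HI HJ HI' HJ'.
  - simpl in *; replace I' with I by lia; replace J' with J by lia.
    rewrite !Nat.eqb_refl; reflexivity.
  - simpl in HI, HJ, HI', HJ'; simpl tp; rewrite IH by
      (apply Nat.Div0.div_lt_upper_bound; assumption).
    rewrite (eqb_div_mod d I I'), (eqb_div_mod c J J').
    unfold diag.
    rewrite (eqb_div_mod c (I mod d * c + J mod c)).
    destruct (divmod_pair c (I mod d) (J mod c)) as [-> ->];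
      [apply Nat.mod_upper_bound; lia|].
    destruct (divmod_pair c (I' mod d) (J' mod c)) as [-> ->];
      [apply Nat.mod_upper_bound; lia|].
    simpl pf; rewrite RtoC_mul.
    destruct (Nat.eqb (I / d) (I' / d)), (Nat.eqb (J / c) (J' / c)),
      (Nat.eqb (I mod d) (I' mod d)), (Nat.eqb (J mod c) (J' mod c));
      simpl; ring.
Qed.

Lemma index_lt n x :
  (x < d ^ n * c ^ n)%nat -> (x / c ^ n < d ^ n /\ x mod c ^ n < c ^ n)%nat.
Proof.
  intros Hx; split.
  - apply Nat.Div0.div_lt_upper_bound; rewrite Nat.mul_comm; exact Hx.
  - apply Nat.mod_upper_bound, Nat.pow_nonzero; clear - c_gt0; lia.
Qed.

Lemma stp_diag n f :
  meq (d ^ n * c ^ n) (d ^ n * c ^ n) (stp d c n (diag f)) (diag (spf d c n f)).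
Proof.
  intros x y Hx Hy; destruct (index_lt n x Hx), (index_lt n y Hy).
  unfold stp; rewrite tp_diag by assumption.
  unfold diag; rewrite (eqb_div_mod (c ^ n) x y); reflexivity.
Qed.

Lemma pf_one n I J : pf d c n (fun _ => 1) I J = 1.
Proof. revert I J; induction n as [|n IH]; intros; simpl; [|rewrite IH]; ring. Qed.

Lemma stp_idm n :
  meq (d ^ n * c ^ n) (d ^ n * c ^ n) (stp d c n idm) idm.
Proof.
  intros x y Hx Hy.
  (* [C1] is [RtoC 1] by computation, so [idm] is the diagonal matrix of the constant [1]. *)
  change (stp d c n idm x y) with (stp d c n (diag (fun _ => 1)) x y).
  rewrite stp_diag by assumption; unfold diag, spf; rewrite pf_one; reflexivity.
Qed.

Lemma unitary_stp n U :
  unitary (d * c) U -> unitary (d ^ n * c ^ n) (stp d c n U).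
Proof.
  intros [H1 H2]; split; intros x y Hx Hy.
  - rewrite <- (stp_idm n x y) by assumption; unfold stp at 3.
    rewrite <- (tp_meq n _ _ _ _ _ _ H1), <- tp_mmul.
    apply csum_ext; intros; unfold adj at 1, stp; rewrite tp_adj; reflexivity.
  - rewrite <- (stp_idm n x y) by assumption; unfold stp at 3.
    rewrite <- (tp_meq n _ _ _ _ _ _ H2), <- tp_mmul.
    apply csum_ext; intros; unfold adj at 1, stp; rewrite tp_adj; reflexivity.
Qed.

(** Products, adjoints and diagonal matrices all pass through the tensor power, so product vectors
    diagonalize it. *)
Lemma spectral_stp n A U l :
  spectral (d * c) A U l ->
  spectral (d ^ n * c ^ n) (stp d c n A) (stp d c n U) (spf d c n l).
Proof.
  intros [HU HA]; split; [apply unitary_stp; assumption|].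
  intros x y Hx Hy; unfold stp at 1; rewrite (tp_meq n _ _ _ _ _ _ HA).
  rewrite <- tp_mmul; apply csum_ext; intros k Hk; unfold stp at 1; f_equal.
  rewrite <- tp_mmul; apply csum_ext; intros l' Hl.
  change (Cmul (stp d c n (diag l) k l') (stp d c n (adj U) l' y) =
    Cmul (diag (spf d c n l) k l') (adj (stp d c n U) l' y)).
  rewrite stp_diag by assumption; f_equal.
  unfold stp, adj at 2; apply tp_adj.
Qed.

Lemma tp_diagonal_entry n W f I J :
  (forall z, (z < d * c)%nat -> W z z = RtoC (f z)) ->
  tp d c n W I J I J = RtoC (pf d c n f I J).
Proof.
  intros H; revert I J; induction n as [|n IH]; intros; [reflexivity|].
  simpl; rewrite IH, H by auto using digit_lt; symmetry; apply RtoC_mul.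
Qed.

(** The left side is a diagonal entry of the tensor power of [V^* W V]. Hence measuring a power of
    [om] in the product eigenbasis of [tau] gives i.i.d. outcomes. *)
Lemma qf_stp n W V p x :
  (forall z, (z < d * c)%nat -> qf (d * c) W (col V z) = RtoC (p z)) ->
  qf (d ^ n * c ^ n) (stp d c n W) (col (stp d c n V) x) = RtoC (spf d c n p x).
Proof.
  intros H; unfold spf.
  rewrite <- (tp_diagonal_entry n (mmul (d * c) (adj V) (mmul (d * c) W V)) p)
    by exact H.
  rewrite <- tp_mmul; apply csum_ext; intros k _.
  rewrite tp_adj, <- tp_mmul; reflexivity.
Qed.

End TensorPower.

(** * Maps tensored with the identity: tensor powers and traces *)

Lemma tpow_ktens_id a b c n K rho I J I' J' :
  (0 < a)%nat -> (0 < b)%nat -> (0 < c)%nat -> (J < c ^ n)%nat -> (J' < c ^ n)%nat ->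
  csum (a ^ n * c ^ n) (fun k => csum (a ^ n * c ^ n) (fun l =>
    Cmul (Cmul (tpow a b K n I I' (k / c ^ n) (l / c ^ n))
               (idK J J' (k mod c ^ n) (l mod c ^ n)))
      (tp a c n rho (k / c ^ n) (k mod c ^ n) (l / c ^ n) (l mod c ^ n))))%nat =
  tp b c n (apply (a * c) (ktens c c K idK) rho) I J I' J'.
Proof.
  intros Ha Hb Hc; revert I J I' J'.
  induction n as [|n IH]; intros I J I' J' HJ HJ'.
  - simpl in *; replace J with 0%nat by lia; replace J' with 0%nat by lia.
    unfold idK; simpl; ring.
  - rewrite (csum_tensor_step a c n (fun k1 k2 =>
      csum (a ^ S n * c ^ S n) (fun l =>
        Cmul (Cmul (tpow a b K (S n) I I' k1 (l / c ^ S n))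
                   (idK J J' k2 (l mod c ^ S n)))
             (tp a c (S n) rho k1 k2 (l / c ^ S n) (l mod c ^ S n)))%nat)).
    (* Once the last local indices [z] and [z'] are summed out, the last factor has become an entry
       of the local output, and the induction hypothesis covers the rest. *)
    rewrite (csum_ext _ _ (fun k => csum (a ^ n * c ^ n) (fun l => Cmul
      (Cmul (Cmul (tpow a b K n (I / b) (I' / b) (k / c ^ n) (l / c ^ n))
                  (idK (J / c) (J' / c) (k mod c ^ n) (l mod c ^ n)))
        (tp a c n rho (k / c ^ n) (k mod c ^ n) (l / c ^ n) (l mod c ^ n)))
      (apply (a * c) (ktens c c K idK) rho (I mod b * c + J mod c)
         (I' mod b * c + J' mod c))))%nat).
    + rewrite (csum_ext _ _ _ (fun k _ => csum_mul_r _ _ _)), csum_mul_r, IH.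
      * reflexivity.
      * apply Nat.Div0.div_lt_upper_bound; exact HJ.
      * apply Nat.Div0.div_lt_upper_bound; exact HJ'.
    + intros k Hk.
      rewrite (csum_ext (a * c) _ (fun z => csum (a ^ n * c ^ n) (fun l =>
        csum (a * c) (fun z' =>
          Cmul (Cmul (Cmul (tpow a b K n (I / b) (I' / b) (k / c ^ n) (l / c ^ n))
                  (idK (J / c) (J' / c) (k mod c ^ n) (l mod c ^ n)))
            (tp a c n rho (k / c ^ n) (k mod c ^ n) (l / c ^ n) (l mod c ^ n)))
           (Cmul (ktens c c K idK (I mod b * c + J mod c) (I' mod b * c + J' mod c)
              z z') (rho z z'))))%nat)).
      * rewrite csum_swap; apply csum_ext; intros l _; unfold apply.
        rewrite <- csum_mul_l; apply csum_ext; intros z _.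
        rewrite csum_mul_l; reflexivity.
      * intros z Hz.
        rewrite (csum_tensor_step a c n (fun l1 l2 => Cmul (Cmul
          (tpow a b K (S n) I I' (k / c ^ n * a + z / c) l1)
          (idK J J' (k mod c ^ n * c + z mod c) l2))
          (tp a c (S n) rho (k / c ^ n * a + z / c) (k mod c ^ n * c + z mod c) l1 l2))%nat).
        apply csum_ext; intros l Hl; apply csum_ext; intros z' Hz'.
        simpl tpow; simpl tp; unfold ktens, idK.
        destruct (digits_snoc a c (k / c ^ n) (k mod c ^ n) z Hc Hz)
          as (E1 & E2 & E3 & E4).
        destruct (digits_snoc a c (l / c ^ n) (l mod c ^ n) z' Hc Hz')
          as (F1 & F2 & F3 & F4).
        (* The identity on the reference compares whole words; the comparison splits into leading
           digits and last digit, one part for each tensor factor. *)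
        rewrite (eqb_div_mod c J (_ + _)), (eqb_div_mod c J' (_ + _)).
        rewrite E1, E2, E3, E4, F1, F2, F3, F4, !div_mul_mod.
        destruct (divmod_pair c (I mod b) (J mod c)) as [-> ->];
          [apply Nat.mod_upper_bound; lia|].
        destruct (divmod_pair c (I' mod b) (J' mod c)) as [-> ->];
          [apply Nat.mod_upper_bound; lia|].
        destruct (Nat.eqb (J / c) (k mod c ^ n)), (Nat.eqb (J' / c) (l mod c ^ n)),
          (Nat.eqb (J mod c) (z mod c)), (Nat.eqb (J' mod c) (z' mod c));
          simpl; ring.
Qed.

Lemma apply_tpow a b c n K rho :
  (0 < a)%nat -> (0 < b)%nat -> (0 < c)%nat ->
  meq (b ^ n * c ^ n) (b ^ n * c ^ n)
    (apply (a ^ n * c ^ n) (ktens (c ^ n) (c ^ n) (tpow a b K n) idK) (stp a c n rho))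
    (stp b c n (apply (a * c) (ktens c c K idK) rho)).
Proof.
  intros Ha Hb Hc x y Hx Hy.
  destruct (index_lt b c Hc n x Hx), (index_lt b c Hc n y Hy).
  unfold stp at 2; rewrite <- tpow_ktens_id by assumption; reflexivity.
Qed.

Lemma TP_ktens_id a b k K X :
  TP a b K -> (0 < k)%nat ->
  trace (b * k) (apply (a * k) (ktens k k K idK) X) = trace (a * k) X.
Proof.
  intros HK Hk.
  (* [Y j] is the j-th diagonal block of [X] with respect to the reference. Only these blocks reach
     the trace, and trace preservation of [K] applies to each. *)
  set (Y := fun j p q => X (p * k + j)%nat (q * k + j)%nat).
  assert (HL : trace (b * k) (apply (a * k) (ktens k k K idK) X) =
    csum b (fun i => csum k (fun j => apply a K (Y j) i i))).
  { rewrite <- (csum_pair b k (fun i j => apply a K (Y j) i i)).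
    apply csum_ext; intros x Hx; unfold apply, ktens, idK.
    assert (Hj : (x mod k < k)%nat) by (apply Nat.mod_upper_bound; lia).
    set (i := (x / k)%nat); set (j := (x mod k)%nat) in *.
    rewrite (csum_ext (a * k) _ (fun p => csum (a * k) (fun q =>
      Cmul (Cmul (K i i (p / k) (q / k))
                 (if Nat.eqb j (p mod k) && Nat.eqb j (q mod k) then C1 else C0))
        (X (p / k * k + p mod k) (q / k * k + q mod k))))%nat%bool) by
      (intros; apply csum_ext; intros; rewrite !div_mul_mod; reflexivity).
    rewrite (csum_pair a k (fun p1 p2 => csum (a * k) (fun q =>
      Cmul (Cmul (K i i p1 (q / k))
                 (if Nat.eqb j p2 && Nat.eqb j (q mod k) then C1 else C0))
        (X (p1 * k + p2) (q / k * k + q mod k))))%nat%bool).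
    apply csum_ext; intros p1 _; unfold Y.
    rewrite <- (csum_delta k j (fun p2 => csum a (fun q1 =>
      Cmul (K i i p1 q1) (X (p1 * k + p2) (q1 * k + j))))%nat Hj).
    apply csum_ext; intros p2 _.
    rewrite (csum_pair a k (fun q1 q2 =>
      Cmul (Cmul (K i i p1 q1)
                 (if Nat.eqb j p2 && Nat.eqb j q2 then C1 else C0))
        (X (p1 * k + p2) (q1 * k + q2)))%nat%bool).
    destruct (Nat.eqb j p2); simpl.
    - apply csum_ext; intros q1 _.
      rewrite <- (csum_delta k j (fun q2 =>
        Cmul (K i i p1 q1) (X (p1 * k + p2) (q1 * k + q2)))%nat Hj).
      apply csum_ext; intros q2 _; destruct (Nat.eqb j q2); ring.
    - rewrite (csum_ext a _ (fun _ => C0)); [apply csum_zero|intros].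
      rewrite (csum_ext k _ (fun _ => C0)); [apply csum_zero|intros; ring]. }
  rewrite HL, csum_swap.
  rewrite (csum_ext k _ (fun j => trace a (Y j))) by (intros j _; apply HK).
  unfold trace; rewrite csum_swap.
  rewrite (csum_ext (a * k) _ (fun x => X (x / k * k + x mod k)
    (x / k * k + x mod k))%nat) by (intros; rewrite div_mul_mod; reflexivity).
  rewrite (csum_pair a k (fun i j => X (i * k + j) (i * k + j))%nat).
  reflexivity.
Qed.

(** * Typical sets *)

Section Typical.

Variables d c : nat.
Hypothesis d_gt0 : (0 < d)%nat.
Hypothesis c_gt0 : (0 < c)%nat.

Lemma rsum_tensor_step n (F : nat -> nat -> R) :
  rsum (d ^ S n * c ^ S n) (fun x => F (x / c ^ S n) (x mod c ^ S n))%nat =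
  rsum (d ^ n * c ^ n) (fun x => rsum (d * c) (fun z =>
    F (x / c ^ n * d + z / c) (x mod c ^ n * c + z mod c)))%nat.
Proof.
  apply RtoC_inj; rewrite !rsum_csum.
  rewrite (csum_tensor_step d c n (fun I J => RtoC (F I J))).
  apply csum_ext; intros; symmetry; apply rsum_csum.
Qed.

Lemma pf_snoc n f I J z :
  (z < d * c)%nat ->
  pf d c (S n) f (I * d + z / c) (J * c + z mod c) = pf d c n f I J * f z.
Proof.
  intros Hz; simpl.
  destruct (digits_snoc d c I J z c_gt0 Hz) as (-> & -> & -> & ->).
  rewrite div_mul_mod; reflexivity.
Qed.

Lemma sf_snoc n f I J z :
  (z < d * c)%nat ->
  sf d c (S n) f (I * d + z / c) (J * c + z mod c) = sf d c n f I J + f z.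
Proof.
  intros Hz; simpl.
  destruct (digits_snoc d c I J z c_gt0 Hz) as (-> & -> & -> & ->).
  rewrite div_mul_mod; reflexivity.
Qed.

Lemma pf_ge0 n f I J :
  (forall z, (z < d * c)%nat -> 0 <= f z) -> 0 <= pf d c n f I J.
Proof.
  intros Hf; revert I J; induction n as [|n IH]; intros; simpl; [lra|].
  apply Rmult_le_pos; auto using digit_lt.
Qed.

Lemma pf_le n f g I J :
  (forall z, (z < d * c)%nat -> 0 <= f z <= g z) -> pf d c n f I J <= pf d c n g I J.
Proof.
  intros H; revert I J; induction n as [|n IH]; intros; simpl; [lra|].
  destruct (H _ (digit_lt d c I J d_gt0 c_gt0)).
  apply Rmult_le_compat; auto; apply pf_ge0; intros; apply H; assumption.
Qed.

(** A positive product of nonnegative factors has all factors positive, so each [ln] is a genuine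
    logarithm rather than its default value [0]. *)
Lemma pf_exp n f I J :
  (forall z, (z < d * c)%nat -> 0 <= f z) -> 0 < pf d c n f I J ->
  pf d c n f I J = exp (sf d c n (fun z => ln (f z)) I J).
Proof.
  intros Hf; revert I J; induction n as [|n IH]; intros I J; simpl.
  - intros _; symmetry; apply exp_0.
  - generalize (pf_ge0 n f (I / d) (J / c) Hf) (Hf _ (digit_lt d c I J d_gt0 c_gt0)).
    set (t := f (I mod d * c + J mod c)%nat); intros [H0|H0] [H1|H1] H.
    + rewrite exp_plus, exp_ln, <- IH by assumption; reflexivity.
    + rewrite <- H1 in H; lra.
    + rewrite <- H0 in H; lra.
    + rewrite <- H0 in H; lra.
Qed.

Section Weights.

Variable f : nat -> R.
Hypothesis f_sum : rsum (d * c) f = 1.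

Lemma spf_sum n : rsum (d ^ n * c ^ n) (spf d c n f) = 1.
Proof.
  induction n as [|n IH]; [simpl; unfold spf; simpl; ring|].
  unfold spf at 1; rewrite (rsum_tensor_step n (pf d c (S n) f)), <- IH.
  apply rsum_ext; intros x _; unfold spf.
  rewrite <- (Rmult_1_r (pf d c n f _ _)), <- f_sum, <- rsum_mul_l.
  apply rsum_ext; intros; apply pf_snoc; assumption.
Qed.

Variable h : nat -> R.
Hypothesis h_centred : rsum (d * c) (fun z => f z * h z) = 0.

(** Appending one letter expands [(q + h z)^2]: the cross term vanishes by [h_centred], and the
    square of [h] adds one local variance. *)
Lemma ssf_variance n :
  rsum (d ^ n * c ^ n) (fun x => spf d c n f x * (ssf d c n h x * ssf d c n h x)) =
  INR n * rsum (d * c) (fun z => f z * (h z * h z)).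
Proof.
  set (var := rsum (d * c) _).
  induction n as [|n IH]; [unfold spf, ssf; simpl; ring|].
  unfold spf at 1, ssf at 1 2.
  rewrite (rsum_tensor_step n (fun I J =>
    pf d c (S n) f I J * (sf d c (S n) h I J * sf d c (S n) h I J))).
  rewrite S_INR, Rmult_plus_distr_r, <- IH, Rmult_1_l.
  rewrite <- (Rmult_1_r var) at 1; rewrite <- (spf_sum n), <- rsum_mul_l, <- rsum_add.
  apply rsum_ext; intros x _; unfold spf, ssf.
  set (p := pf d c n f _ _); set (q := sf d c n h _ _).
  transitivity (p * (q * q) * rsum (d * c) f
    + 2 * p * q * rsum (d * c) (fun z => f z * h z) + p * var).
  - unfold var; rewrite <- !rsum_mul_l, <- !rsum_add; apply rsum_ext; intros z Hz.
    rewrite pf_snoc, sf_snoc by assumption; fold p q; ring.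
  - rewrite f_sum, h_centred; ring.
Qed.

End Weights.

Definition mean (f g : nat -> R) : R := rsum (d * c) (fun z => f z * g z).
Definition variance (f g : nat -> R) : R :=
  rsum (d * c) (fun z => f z * ((g z - mean f g) * (g z - mean f g))).

Lemma sf_centre n g m I J :
  sf d c n (fun z => g z - m) I J = sf d c n g I J - INR n * m.
Proof.
  revert I J; induction n as [|n IH]; intros; simpl sf; [simpl; ring|].
  rewrite IH, S_INR; ring.
Qed.

(** Markov's inequality for the squared deviation, with [n] times the local variance against
    [(n delta)^2]. The weight [t] stands for the indicator of the atypical words. *)
Lemma chebyshev n f g t delta :
  (0 < n)%nat -> 0 < delta ->
  (forall z, (z < d * c)%nat -> 0 <= f z) -> rsum (d * c) f = 1 ->
  (forall x, 0 <= t x <= 1) ->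
  (forall x, 0 < spf d c n f x -> t x <> 0 ->
     INR n * delta <= Rabs (ssf d c n g x - INR n * mean f g)) ->
  rsum (d ^ n * c ^ n) (fun x => t x * spf d c n f x) <=
  variance f g / delta ^ 2 / INR n.
Proof.
  intros Hn Hd Hf Hsum Ht Hdev.
  assert (Hn' : 0 < INR n) by (apply lt_0_INR; assumption).
  assert (Hc : rsum (d * c) (fun z => f z * (g z - mean f g)) = 0).
  { rewrite (rsum_ext _ _ (fun z => f z * g z - mean f g * f z)) by (intros; ring).
    rewrite rsum_sub, rsum_mul_l, Hsum; unfold mean; ring. }
  generalize (ssf_variance f Hsum _ Hc n); fold (variance f g); intros Hv.
  assert (H : (INR n * delta) ^ 2 *
    rsum (d ^ n * c ^ n) (fun x => t x * spf d c n f x) <= INR n * variance f g).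
  { rewrite <- Hv, <- rsum_mul_l; apply rsum_le; intros x _.
    generalize (pf_ge0 n f (x / c ^ n) (x mod c ^ n) Hf).
    fold (spf d c n f x); intros [Hp|Hp]; [|rewrite <- Hp; lra].
    replace (ssf d c n (fun z => g z - mean f g) x)
      with (ssf d c n g x - INR n * mean f g) by (symmetry; apply sf_centre).
    destruct (Req_dec (t x) 0) as [H0|H0].
    - rewrite H0; set (q := ssf d c n g x - _).
      replace (_ * (0 * _)) with 0 by ring.
      apply Rmult_le_pos; [lra|apply Rle_0_sqr].
    - specialize (Hdev x Hp H0); specialize (Ht x).
      set (q := ssf d c n g x - _) in *.
      assert (Hq : (INR n * delta) ^ 2 <= q * q).
      { rewrite <- Rsqr_pow2; change (q * q) with (Rsqr q).
        rewrite (Rsqr_abs q); apply Rsqr_incr_1; auto using Rabs_pos; nra. }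
      replace (_ * (t x * _)) with (spf d c n f x * (t x * (INR n * delta) ^ 2)) by ring.
      apply Rmult_le_compat_l; [lra|].
      assert (0 <= (INR n * delta) ^ 2) by apply pow2_ge_0; nra. }
  apply Rmult_le_reg_l with ((INR n * delta) ^ 2).
  - apply pow_lt; apply Rmult_lt_0_compat; assumption.
  - apply Rle_trans with (1 := H); right; field; lra.
Qed.

End Typical.

(** * Linearity of quadratic forms, traces and maps *)

Lemma qf_meq d A B v : meq d d A B -> qf d A v = qf d B v.
Proof. intros H; apply ip_ext; intros; [|apply mv_meq]; auto. Qed.

Lemma qf_sub d A B v :
  qf d (fun i j => Csub (A i j) (B i j)) v = Csub (qf d A v) (qf d B v).
Proof.
  unfold qf, ip, mv, Csub; rewrite <- csum_opp, <- csum_add.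
  apply csum_ext; intros i _.
  transitivity (Cmul (Cconj (v i)) (Cadd (csum d (fun j => Cmul (A i j) (v j)))
    (Copp (csum d (fun j => Cmul (B i j) (v j)))))); [f_equal|ring].
  rewrite <- csum_opp, <- csum_add; apply csum_ext; intros; ring.
Qed.

Lemma qf_scale d x A v :
  qf d (fun i j => Cmul (RtoC x) (A i j)) v = Cmul (RtoC x) (qf d A v).
Proof.
  unfold qf, ip, mv; rewrite <- csum_mul_l; apply csum_ext; intros i _.
  transitivity (Cmul (Cconj (v i)) (Cmul (RtoC x) (csum d (fun j => Cmul (A i j) (v j)))));
    [f_equal|ring].
  rewrite <- csum_mul_l; apply csum_ext; intros; ring.
Qed.

Lemma trace_meq d A B : meq d d A B -> trace d A = trace d B.
Proof. intros H; apply csum_ext; auto. Qed.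

Lemma trace_sub d A B :
  trace d (fun i j => Csub (A i j) (B i j)) = Csub (trace d A) (trace d B).
Proof. unfold trace, Csub; rewrite csum_add, csum_opp; reflexivity. Qed.

Lemma apply_Ksub_ktens d a k K1 K2 X :
  meq d d (apply a (ktens k k (Ksub K1 K2) idK) X)
    (fun i j => Csub (apply a (ktens k k K1 idK) X i j)
                     (apply a (ktens k k K2 idK) X i j)).
Proof.
  intros i j _ _; unfold apply, Csub; rewrite <- csum_opp, <- csum_add.
  apply csum_ext; intros; rewrite <- csum_opp, <- csum_add.
  apply csum_ext; intros; unfold ktens, Ksub; ring.
Qed.

Lemma apply_Kscale_ktens a k x K X i j :
  apply a (ktens k k (Kscale x K) idK) X i j =
  Cmul (RtoC x) (apply a (ktens k k K idK) X i j).
Proof.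
  unfold apply; rewrite <- csum_mul_l; apply csum_ext; intros.
  rewrite <- csum_mul_l; apply csum_ext; intros; unfold ktens, Kscale; ring.
Qed.

(** * Block channels *)

Section StrongConverse.

Variables (eps : R) (a b c : nat) (N M : SupOp) (rho : Mat).
Hypothesis eps_lt1 : eps < 1.
Hypothesis a_gt0 : (0 < a)%nat.
Hypothesis b_gt0 : (0 < b)%nat.
Hypothesis c_gt0 : (0 < c)%nat.
Hypothesis rho_density : density (a * c) rho.

Let om := apply (a * c) (ktens c c N idK) rho.
Let tau := apply (a * c) (ktens c c M idK) rho.

Variables (U V : Mat) (lam mu m : nat -> R).
Hypothesis om_spectral : spectral (b * c) om U lam.
Hypothesis tau_spectral : spectral (b * c) tau V mu.
Hypothesis lam_ge0 : forall z, (z < b * c)%nat -> 0 <= lam z.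
Hypothesis lam_sum : rsum (b * c) lam = 1.
(** A strictly positive majorant [m] of the spectrum of [tau] keeps [ln (m z)] meaningful where
    [mu z] vanishes. *)
Hypothesis mu_le : forall z, (z < b * c)%nat -> 0 <= mu z <= m z.
Hypothesis m_gt0 : forall z, (z < b * c)%nat -> 0 < m z.

Let p z := re (qf (b * c) om (col V z)).
(** [H] is [Tr om log om], minus the von Neumann entropy of [om]; [L] is [Tr om log tau] with the
    spectrum of [tau] raised to [m]. *)
Let H := mean b c lam (fun z => ln (lam z)).
Let L := mean b c p (fun z => ln (m z)).

Lemma p_real z : qf (b * c) om (col V z) = RtoC (p z).
Proof. unfold p; rewrite (qf_spectral _ _ _ _ _ om_spectral); reflexivity. Qed.

Lemma p_ge0 z : 0 <= p z.
Proof.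
  unfold p; rewrite (qf_spectral _ _ _ _ _ om_spectral); apply rsum_ge0; intros.
  apply Rmult_le_pos; [auto|apply Cnorm2_ge0].
Qed.

Lemma p_sum : rsum (b * c) p = 1.
Proof.
  rewrite <- lam_sum; apply sum_qf_col with (U := U).
  - apply om_spectral.
  - apply tau_spectral.
  - apply om_spectral.
Qed.

Lemma tensor_input n :
  psd (a ^ n * c ^ n) (stp a c n rho) /\ trace (a ^ n * c ^ n) (stp a c n rho) = C1 /\
  trace_norm_le (a ^ n * c ^ n) (stp a c n rho) 1.
Proof.
  destruct rho_density as [Hpsd Htr].
  destruct (Spectral.hermitian_spectral (proj1 Hpsd)) as (W & l & HS).
  assert (Hl : forall z, (z < a * c)%nat -> 0 <= l z)
    by (intros; apply (psd_eigenvalue _ _ _ _ _ Hpsd HS); assumption).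
  assert (Hsum : rsum (a * c) l = 1).
  { apply RtoC_inj; rewrite <- (trace_spectral _ _ _ _ HS); exact Htr. }
  generalize (spectral_stp a c a_gt0 c_gt0 n rho W l HS); intros HSn.
  assert (Hln : forall x, 0 <= spf a c n l x) by (intros; apply pf_ge0; assumption).
  generalize (spf_sum a c c_gt0 l Hsum n); intros Hsn.
  repeat split.
  - apply (psd_of_spectral _ _ _ _ HSn); auto.
  - apply (psd_of_spectral _ _ _ _ HSn); auto.
  - rewrite (trace_spectral _ _ _ _ HSn), Hsn; reflexivity.
  (* With nonnegative eigenvalues the spectral decomposition is already a singular value
     decomposition. *)
  - exists 1; split; [|lra]; destruct HSn as [HU Heq].
    exists (stp a c n W), (stp a c n W), (spf a c n l); auto 6.
Qed.

Section Blocklength.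

Variables (n : nat) (delta : R).
Hypothesis n_gt0 : (0 < n)%nat.
Hypothesis delta_gt0 : 0 < delta.

Let D := (b ^ n * c ^ n)%nat.
(** [s] and [r] are the spectra of [P] and [Q]. The threshold in [r] is put on [m], and through
    [mu <= m] it also bounds the eigenvalues of the power of [tau]. *)
Let s x := if Rle_dec (exp (INR n * (H - delta))) (spf b c n lam x) then 1 else 0.
Let r x := if Rle_dec (spf b c n m x) (exp (INR n * (L + delta))) then 1 else 0.

(** Every selected eigenvalue is at least [exp (INR n * (H - delta))], and all of them together sum
    to [1]. *)
Lemma typical_card : rsum D s <= exp (- (INR n * (H - delta))).
Proof.
  apply Rmult_le_reg_l with (exp (INR n * (H - delta))); [apply exp_pos|].
  rewrite <- exp_plus, Rplus_opp_r, exp_0, <- rsum_mul_l.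
  rewrite <- (spf_sum b c c_gt0 lam lam_sum n); apply rsum_le; intros x _.
  unfold s; destruct (Rle_dec _ _); [lra|].
  rewrite Rmult_0_r; apply pf_ge0; assumption.
Qed.

Lemma typical_first :
  rsum D (fun x => (1 - s x) * spf b c n lam x) <=
  variance b c lam (fun z => ln (lam z)) / delta ^ 2 / INR n.
Proof.
  apply chebyshev; auto.
  - intros x; unfold s; destruct (Rle_dec _ _); lra.
  - intros x Hx; unfold s; destruct (Rle_dec _ _) as [|Hlt]; intros Hs; [lra|].
    apply Rnot_le_lt in Hlt; unfold spf in Hlt, Hx.
    rewrite (pf_exp b c b_gt0 c_gt0) in Hlt by assumption.
    apply exp_lt_inv in Hlt; fold (ssf b c n (fun z => ln (lam z)) x) in Hlt.
    assert (0 < INR n * delta)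
      by (apply Rmult_lt_0_compat; [apply lt_0_INR|]; assumption).
    fold H; rewrite Rabs_left1; lra.
Qed.

Lemma typical_second :
  rsum D (fun x => (1 - r x) * spf b c n p x) <=
  variance b c p (fun z => ln (m z)) / delta ^ 2 / INR n.
Proof.
  apply chebyshev; auto using p_sum.
  - intros; apply p_ge0.
  - intros x; unfold r; destruct (Rle_dec _ _); lra.
  - intros x Hx; unfold r; destruct (Rle_dec _ _) as [|Hlt]; intros Hs; [lra|].
    apply Rnot_le_lt in Hlt; unfold spf in Hlt.
    rewrite (pf_exp b c b_gt0 c_gt0) in Hlt.
    + apply exp_lt_inv in Hlt; fold (ssf b c n (fun z => ln (m z)) x) in Hlt.
      assert (0 < INR n * delta)
        by (apply Rmult_lt_0_compat; [apply lt_0_INR|]; assumption).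
      fold L; rewrite Rabs_right; lra.
    + intros; apply Rlt_le; auto.
    + apply Rlt_trans with (2 := Hlt); apply exp_pos.
Qed.

Lemma smooth_Dmax_block N' L0 :
  channel (a ^ n) (b ^ n) N' ->
  diamond_le (a ^ n) (b ^ n) (Ksub N' (tpow a b N n)) (2 * eps) ->
  0 < L0 ->
  CP (a ^ n) (b ^ n) (Ksub (Kscale L0 (tpow a b M n)) N') ->
  1 - eps - (variance b c lam (fun z => ln (lam z))
             + 2 * variance b c p (fun z => ln (m z))) / delta ^ 2 / INR n <=
  L0 * exp (INR n * (L - H + 2 * delta)).
Proof.
  intros [_ HTP] Hdiam HL0 HCP.
  destruct (tensor_input n) as (Hpsd & Htr & Hnorm).
  set (rn := stp a c n rho) in *; set (k := (c ^ n)%nat) in *.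
  set (om' := apply (a ^ n * k) (ktens k k N' idK) rn).
  generalize (apply_tpow a b c n N rho a_gt0 b_gt0 c_gt0); fold rn k om; intros HomN.
  generalize (apply_tpow a b c n M rho a_gt0 b_gt0 c_gt0); fold rn k tau; intros HtauM.
  generalize (spectral_stp b c b_gt0 c_gt0 n _ _ _ om_spectral); intros HSo.
  generalize (spectral_stp b c b_gt0 c_gt0 n _ _ _ tau_spectral); intros HSt.
  fold k D in HomN, HtauM, HSo, HSt.
  set (X := apply (a ^ n * k) (ktens k k (Ksub N' (tpow a b N n)) idK) rn).
  assert (Hk : (0 < k)%nat) by (generalize (Nat.pow_nonzero c n); unfold k; lia).
  (* Both outputs have trace one. *)
  assert (HtrX : re (trace D X) = 0).
  { rewrite (trace_meq D X _ (apply_Ksub_ktens D _ _ _ _ _)).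
    rewrite trace_sub.
    rewrite (trace_meq D _ _ HomN), (trace_spectral _ _ _ _ HSo).
    change D with (b ^ n * k)%nat at 1; rewrite (TP_ktens_id _ _ _ _ _ HTP Hk), Htr.
    unfold D, k; rewrite spf_sum by assumption; simpl; ring. }
  assert (HX : forall v, re (qf D X v) = re (qf D om' v) - re (qf D (stp b c n om) v)).
  { intros v; rewrite (qf_meq D X _ v (apply_Ksub_ktens D _ _ _ _ _)), qf_sub.
    fold om'; rewrite (qf_meq D _ _ v HomN); simpl; ring. }
  (* Complete positivity is used with a reference of dimension [c ^ n], on the input [rn]. *)
  assert (Hle : forall v, re (qf D om' v) <= L0 * re (qf D (stp b c n tau) v)).
  { intros v; generalize (psd_qf D _ v (HCP k rn Hpsd)).
    rewrite (qf_meq D _ _ v (apply_Ksub_ktens D _ _ _ _ _)), qf_sub; fold om'.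
    rewrite (qf_meq D _ (fun i j => Cmul (RtoC L0) (apply (a ^ n * k)
      (ktens k k (tpow a b M n) idK) rn i j))) by
      (intros i j _ _; apply apply_Kscale_ktens).
    rewrite qf_scale, (qf_meq D _ _ v HtauM); simpl; lra. }
  generalize typical_first typical_second typical_card; intros T1 T2 T3.
  set (th1 := variance b c lam _ / _ / _) in T1; set (th2 := variance b c p _ / _ / _) in T2.
  assert (Hmain : 1 - th1 - 2 * th2 - eps <= L0 * exp (INR n * (L + delta)) * rsum D s).
  { apply one_shot_converse with (U := stp b c n U) (V := stp b c n V) (r := r)
      (om := stp b c n om) (om' := om') (tau := stp b c n tau) (X := X)
      (lam := spf b c n lam) (mu := spf b c n mu); try assumption.
    - apply HSo.
    - apply HSt.
    - intros x; unfold s; destruct (Rle_dec _ _); lra.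
    - intros x; unfold r; destruct (Rle_dec _ _); lra.
    - intros; apply pf_ge0; assumption.
    - apply spf_sum; assumption.
    - apply Rlt_le, exp_pos.
    - intros x _; unfold r; destruct (Rle_dec _ _) as [Hx|].
      + apply Rle_trans with (2 := Hx); rewrite !Rmult_1_l.
        apply pf_le; assumption.
      + rewrite !Rmult_0_l; apply Rlt_le, exp_pos.
    - rewrite (rsum_ext D _ (fun x => (1 - r x) * spf b c n p x)); [exact T2|].
      intros x _; change D with (b ^ n * c ^ n)%nat; rewrite (qf_stp b c b_gt0 c_gt0 n om V p x);
        [reflexivity|intros; apply p_real].
    - lra.
    - apply Hdiam; exact Hnorm. }
  replace (1 - eps - _) with (1 - th1 - 2 * th2 - eps).
  2:{ unfold th1, th2; field; split; [lra|apply not_0_INR; lia]. }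
  apply Rle_trans with (1 := Hmain).
  replace (INR n * (L - H + 2 * delta))
    with (INR n * (L + delta) + - (INR n * (H - delta))) by ring.
  rewrite exp_plus, <- Rmult_assoc; apply Rmult_le_compat_l; [|exact T3].
  apply Rmult_le_pos; [lra|apply Rlt_le, exp_pos].
Qed.

End Blocklength.

Lemma smooth_Dmax_strong_converse y :
  y < H - L ->
  exists n0 : nat, forall n : nat, (n0 <= n)%nat -> (0 < n)%nat ->
    smooth_Dmax_ge eps (a ^ n) (b ^ n) (tpow a b N n) (tpow a b M n) (INR n * y).
Proof.
  intros Hy.
  (* With a third of the gap, the exponent [L - H + 2 * delta] becomes [- y - delta], leaving a
     spare decay [exp (- n delta)]. *)
  set (delta := (H - L - y) / 3).
  set (C := (variance b c lam (fun z => ln (lam z))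
             + 2 * variance b c p (fun z => ln (m z))) / delta ^ 2).
  assert (Hd : 0 < delta) by (unfold delta; lra).
  (* The first bound makes the Chebyshev error at most [(1 - eps) / 2]; the second makes
     [exp (n delta)] at least [2 / (1 - eps)], through [exp x >= 1 + x]. *)
  destruct (INR_unbounded (Rmax (2 * C / (1 - eps)) (2 / ((1 - eps) * delta)))) as [n0 Hn0].
  exists n0; intros n Hn Hpos N' HN' Hdiam L0 HL0 HCP.
  generalize (smooth_Dmax_block n delta Hpos Hd N' L0 HN' Hdiam HL0 HCP); fold C.
  replace (L - H + 2 * delta) with (- y - delta) by (unfold delta; field).
  intros Hmain.
  assert (HnR : INR n0 <= INR n) by (apply le_INR; assumption).
  assert (Hn' : 0 < INR n) by (apply lt_0_INR; assumption).
  generalize (Rmax_l (2 * C / (1 - eps)) (2 / ((1 - eps) * delta)))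
    (Rmax_r (2 * C / (1 - eps)) (2 / ((1 - eps) * delta))); intros Hl Hr.
  assert (H1 : C / INR n <= (1 - eps) / 2).
  { apply Rmult_le_reg_r with (INR n); [assumption|].
    replace (C / INR n * INR n) with ((1 - eps) / 2 * (2 * C / (1 - eps))) by (field; lra).
    apply Rmult_le_compat_l; lra. }
  assert (H2 : 2 / (1 - eps) <= exp (INR n * delta)).
  { apply Rle_trans with (INR n * delta).
    - replace (2 / (1 - eps)) with (2 / ((1 - eps) * delta) * delta) by (field; lra).
      apply Rmult_le_compat_r; lra.
    - generalize (exp_ineq1_le (INR n * delta)); lra. }
  (* If [ln L0 < n y], then [L0 < exp (n y)], whereas [Hmain] with the two bounds gives
     [L0 >= exp (n y)]. *)
  apply Rnot_lt_le; intros Hlt; apply exp_increasing in Hlt.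
  rewrite exp_ln in Hlt by assumption.
  replace (INR n * (- y - delta)) with (- (INR n * y) + - (INR n * delta)) in Hmain by ring.
  rewrite exp_plus, !exp_Ropp in Hmain.
  generalize (exp_pos (INR n * y)); set (ey := exp (INR n * y)) in *; intros Hey.
  set (ed := exp (INR n * delta)) in *.
  assert (Hinv : 0 < 2 / (1 - eps)) by (apply Rdiv_lt_0_compat; lra).
  assert (Hed : 1 <= ed * ((1 - eps) / 2)).
  { replace 1 with (2 / (1 - eps) * ((1 - eps) / 2)) at 1 by (field; lra).
    apply Rmult_le_compat_r; lra. }
  assert (H3 : (1 - eps) / 2 <= L0 * (/ ey * / ed)) by lra.
  apply Rmult_le_compat_l with (r := ey * ed) in H3; [|apply Rmult_le_pos; lra].
  replace (ey * ed * (L0 * (/ ey * / ed))) with L0 in H3 by (field; lra).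
  apply Rmult_le_compat_l with (r := ey) in Hed; lra.
Qed.

End StrongConverse.

(* [Stdlib.ln] takes the junk value [0] off the positive reals. *)
Lemma ln_nonpos x : x <= 0 -> ln x = 0.
Proof. intros Hx; unfold ln; destruct (Rlt_dec 0 x); [exfalso; lra|reflexivity]. Qed.

(* liminf_n (1/n) D^eps_max(N^{(x)n} || M^{(x)n}) >= D(N || M), written as:
   for every y < D(N||M), eventually (1/n) D^eps_max(...) >= y. *)
Theorem mainTheorem5 (eps : R) (a b : nat) (N M : SupOp) :
  0 < eps < 1 ->
  channel a b N -> channel a b M ->
  forall y : R, channel_rel_entropy_gt a b N M y ->
  exists n0 : nat, forall n : nat, (n0 <= n)%nat -> (0 < n)%nat ->
    smooth_Dmax_ge eps (a ^ n) (b ^ n) (tpow a b N n) (tpow a b M n) (INR n * y).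
Proof.
  intros [_ Heps] [HNcp HNtp] [HMcp _] y (c & rho & dd & Hrho & HD & Hy).
  destruct HD as (U & V & lam & mu & HSo & HSt & Hcases); simpl in Hcases.
  set (om := apply (a * c) (ktens c c N idK) rho) in *.
  set (tau := apply (a * c) (ktens c c M idK) rho) in *.
  set (p := fun j => re (mmul (b * c) (adj V) (mmul (b * c) om V) j j)) in *.
  destruct Hrho as [Hpsd Htr]; generalize (conj Hpsd Htr); intros Hrho.
  (* A matrix of trace one cannot have dimension zero; this yields positivity of [a] and [c], and of
     [b] through the output. *)
  assert (Hac : (a * c <> 0)%nat).
  { intros H0; rewrite H0 in Htr; apply (f_equal re) in Htr; simpl in Htr; lra. }
  assert (Hc : (0 < c)%nat) by nia; assert (Ha : (0 < a)%nat) by nia.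
  assert (Htro : trace (b * c) om = C1)
    by (unfold om; rewrite (TP_ktens_id _ _ _ _ _ HNtp Hc); exact Htr).
  assert (Hbc : (b * c <> 0)%nat).
  { intros H0; rewrite H0 in Htro; apply (f_equal re) in Htro; simpl in Htro; lra. }
  assert (Hb : (0 < b)%nat) by nia.
  assert (Hlam : forall z, (z < b * c)%nat -> 0 <= lam z)
    by (intros; apply (psd_eigenvalue _ _ _ _ _ (HNcp c rho Hpsd) HSo); assumption).
  assert (Hmu : forall z, (z < b * c)%nat -> 0 <= mu z)
    by (intros; apply (psd_eigenvalue _ _ _ _ _ (HMcp c rho Hpsd) HSt); assumption).
  assert (Hsum : rsum (b * c) lam = 1)
    by (apply RtoC_inj; rewrite <- (trace_spectral _ _ _ _ HSo); exact Htro).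
  assert (Hp : forall z, 0 <= p z).
  { intros z; change (0 <= re (qf (b * c) om (col V z))).
    rewrite (qf_spectral _ _ _ _ _ HSo); apply rsum_ge0; intros.
    apply Rmult_le_pos; [auto|apply Cnorm2_ge0]. }
  set (Hlam1 := rsum (b * c) (fun i => lam i * ln (lam i))) in *.
  (* Vanishing eigenvalues of [tau] are raised to [exp (- K)]: [K = 0] suffices
     if [D] is finite, while [- Tr om log tau] diverges with [K] otherwise. *)
  set (m := fun K z => if Rlt_dec 0 (mu z) then mu z else exp (- K)).
  assert (HK : exists K, y < Hlam1 - rsum (b * c) (fun z => p z * ln (m K z))).
  { destruct Hcases as [[(j & Hj & Hmuj & Hpj) ->] | [Hnv ->]]; simpl in Hy.
    (* Since [ln 0 = 0] here, [B] collects the positive eigenvalues of [tau] only. *)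
    - set (B := rsum (b * c) (fun z => p z * ln (mu z))).
      assert (Hpj' : 0 < p j)
        by (destruct (Hp j) as [|E]; [assumption|elim Hpj; symmetry; exact E]).
      (* The quotient makes [p j * K] exceed [y - Hlam1 + B] by at least [1]; [K >= 0] keeps the
         contributions of the other vanishing eigenvalues nonnegative. *)
      exists (Rmax 0 ((y - Hlam1 + B + 1) / p j)).
      set (K := Rmax _ _).
      assert (HK0 : 0 <= K) by apply Rmax_l.
      assert (HK1 : (y - Hlam1 + B + 1) / p j <= K) by apply Rmax_r.
      apply Rmult_le_compat_r with (r := p j) in HK1; [|lra].
      replace ((y - Hlam1 + B + 1) / p j * p j) with (y - Hlam1 + B + 1) in HK1
        by (field; lra).
      assert (Hterm : p j * K <=
        rsum (b * c) (fun z => p z * ln (mu z) - p z * ln (m K z))).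
      { apply Rle_trans with (p j * ln (mu j) - p j * ln (m K j)).
        - unfold m; destruct (Rlt_dec 0 (mu j)); [lra|].
          rewrite ln_exp, ln_nonpos by lra; lra.
        - apply (rsum_ge_term (b * c) j (fun z => p z * ln (mu z) - p z * ln (m K z)) Hj).
          intros z Hz; unfold m; destruct (Rlt_dec 0 (mu z)); [lra|].
          rewrite ln_exp, ln_nonpos by lra; generalize (Hp z); nra. }
      rewrite rsum_sub in Hterm; fold B in Hterm; lra.
    - exists 0.
      rewrite (rsum_ext _ (fun z => p z * ln (m 0 z)) (fun z => p z * ln (mu z)));
        [exact Hy|].
      intros z Hz; unfold m; destruct (Rlt_dec 0 (mu z)); [reflexivity|].
      (* Without a support violation [p] vanishes wherever [mu] does, so raising those eigenvalues
         leaves the sum unchanged. *)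
      destruct (Req_dec (p z) 0) as [->|Hpz]; [ring|].
      exfalso; apply Hnv; exists z; repeat split; auto.
      generalize (Hmu z Hz); lra. }
  destruct HK as (K & HK).
  apply (smooth_Dmax_strong_converse eps a b c N M rho) with (U := U) (V := V)
    (lam := lam) (mu := mu) (m := m K); auto.
  - intros z Hz; unfold m; destruct (Rlt_dec 0 (mu z)); [split; auto; lra|].
    split; [auto|apply Rle_trans with 0; [lra|apply Rlt_le, exp_pos]].
  - intros z _; unfold m; destruct (Rlt_dec 0 (mu z)); [lra|apply exp_pos].
Qed.
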